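(* Let $n\ge1$. The assignment $$\tilde s_{[1,j]\sqcup[2n-j,2n-1]}\mapsto q^{A_{2n-1}}_{[1,j]\sqcup[2n-j,2n-1]}\ (1\le j<n),\qquad \tilde s_{[j,2n-j]}\mapsto q^{A_{2n-1}}_{[j,2n-j]}\ (1\le j\le n)$$ defines a group epimorphism from the virtual symplectic cactus group $\widetilde J_{2n}$ onto the virtual symplectic Berenstein–Kirillov group $\widetilde{\mathcal{BK}}_{2n}$. The group $\widetilde{\mathcal{BK}}_{2n}$ is isomorphic to a quotient of $\widetilde J_{2n}$ and, via the isomorphism between $J_{\mathfrak{sp}(2n,\mathbb C)}$ and $\widetilde J_{2n}$ defined by $s_{[1,j]}\mapsto\tilde s_{[1,j]\sqcup[2n-j,2n-1]}$ ($1\le j<n$) and $s_{[j,n]}\mapsto\tilde s_{[j,2n-j]}$ ($1\le j\le n$), it is also isomorphic to a quotient of $J_{\mathfrak{sp}(2n,\mathbb C)}$.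
   Context: **Cactus groups.** Intervals $[p,q]=\{p,\dots,q\}$ are sub-diagrams of Dynkin diagrams; $J\sqcup J'$ is disconnected if no node of $J$ is equal or adjacent to a node of $J'$. $J_{\mathfrak{sp}(2n,\mathbb C)}$ has generators $s_{[p,q]}$, $[p,q]\subseteq[n]$, and relations: $s_J^2=1$; $s_Js_{J'}=s_{J'}s_J$ if $J\sqcup J'$ is disconnected; $s_{[p,n]}s_{[k,l]}=s_{[k,l]}s_{[p,n]}$ for $[k,l]\subseteq[p,n]$; $s_{[p,q]}s_{[k,l]}=s_{[p+q-l,p+q-k]}s_{[p,q]}$ for $[k,l]\subseteq[p,q]\subseteq[n-1]$. $\widetilde J_{2n}$ is the group with generators $\tilde s_J$, where $J$ runs over the sub-diagrams of $[2n-1]$ of the form $[p,2n-p]$ with $1\le p\le n$, or $[p,q]\sqcup[2n-q,2n-p]$ with $[p,q]\subseteq[n-1]$, subject to: $\tilde s_J^2=1$; $\tilde s_J\tilde s_{J'}=\tilde s_{J'}\tilde s_J$ whenever $J\sqcup J'$ is disconnected; $\tilde s_{[p,2n-p]}$ commutes with $\tilde s_{[q,l]\sqcup[2n-l,2n-q]}$ for $[q,l]\subseteq[p,n]\subseteq[n]$ (for $l=n$ the index means $[q,2n-q]$); $\tilde s_{[p,q]\sqcup[2n-q,2n-p]}\tilde s_{[k,l]\sqcup[2n-l,2n-k]}=\tilde s_{[p+q-l,p+q-k]\sqcup[2n-(p+q)+k,2n-(p+q)+l]}\tilde s_{[p,q]\sqcup[2n-q,2n-p]}$ for $[k,l]\subseteq[p,q]\subseteq[n-1]$.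 It is generated by the $\tilde s_{[1,j]\sqcup[2n-j,2n-1]}$ ($1\le j<n$) and $\tilde s_{[j,2n-j]}$ ($1\le j\le n$). **Bender–Knuth involutions.** For $i\ge1$, $t_i$ acts on a semistandard tableau $T$ as follows: within each column containing both $i$ and $i+1$ these two entries are fixed; the other occurrences of $i$ and $i+1$ are free; in each row with $k$ free $i$'s followed by $l$ free $(i+1)$'s, replace them by $l$ free $i$'s followed by $k$ free $(i+1)$'s. **Berenstein–Kirillov groups.** $\mathcal{BK}_{2n}$ is the group generated by $t_1,\dots,t_{2n-1}$ modulo the relations they satisfy on semistandard tableaux of any straight shape; equivalently the subgroup they generate in the group of permutations of $\bigsqcup_\mu\mathsf{SSYT}(\mu,2n)$, with $\mathsf{SSYT}(\mu,2n)$ the semistandard tableaux of shape $\mu$ with entries in $[2n]$. In it, $q^{A_{2n-1}}_{[1,i]}:=t_1(t_2t_1)\cdots(t_it_{i-1}\cdots t_1)$ and $q^{A_{2n-1}}_{[j,k-1]}:=q_{[1,k-1]}q_{[1,k-j]}q_{[1,k-1]}$ for $j<k$. $\widetilde{\mathcal{BK}}_{2n}$ is the subgroup of $\mathcal{BK}_{2n}$ generated by $q^{A_{2n-1}}_{[1,i]\sqcup[2n-i,2n-1]}:=q^{A_{2n-1}}_{[1,i]}q^{A_{2n-1}}_{[2n-i,2n-1]}$ ($1\le i<n$) and $q^{A_{2n-1}}_{[i,2n-i]}$ ($1\le i\le n$). *)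

(* Defs.v *)
From HB Require Import structures.
From mathcomp Require Import all_boot boolp.
Set Implicit Arguments.
Unset Strict Implicit.
Unset Printing Implicit Defensive.

Local Open Scope group_scope.
Local Open Scope quotient_scope.

Definition isomorphic (G H : groupType) : Prop :=
  exists f : {multiplicative G -> H}, bijective f.

Section Generated.
Variables (G : groupType) (A : G -> Prop).

Definition generated : pred G := fun x =>
  `[< forall H : {pred G}, group_closed H ->
        (forall a, A a -> a \in H) -> x \in H >].

Lemma generated_closed : group_closed generated.
Proof.
split=> [|x y /asboolP hx /asboolP hy]; apply/asboolP=> H cH AH.
  by case: cH.
by case: (cH) => _; apply; [exact: hx | exact: hy].
Qed.

Lemma generated_sub a : A a -> generated a.
Proof. by move=> Aa; apply/asboolP=> H _; apply. Qed.

Record gen_group := GenGroup { gval : G; _ : generated gval }.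

HB.instance Definition _ := [isSub for gval].
HB.instance Definition _ := [Choice of gen_group by <:].
HB.instance Definition _ :=
  SubChoice_isSubGroup.Build G generated gen_group generated_closed.

End Generated.

Record normal_subgroup (G : groupType) := NormalSubgroup {
  nsub :> {pred G};
  nsub_closed : group_closed nsub;
  nsub_conj : forall x y : G, x \in nsub -> x ^ y \in nsub }.

Section Quotient.
Variables (G : groupType) (N : normal_subgroup G).
Implicit Types x y z : G.

Definition coset_rel : rel G := fun x y => x^-1 * y \in nsub N.

Lemma coset_rel_refl : reflexive coset_rel.
Proof. by move=> x; rewrite /coset_rel mulVg; case: (nsub_closed N). Qed.

Lemma coset_rel_sym : symmetric coset_rel.
Proof.
suff h x y : coset_rel x y -> coset_rel y x by move=> x y; apply/idP/idP; apply: h.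
by move=> /(group_closedV (nsub_closed N)); rewrite /coset_rel invgM invgK.
Qed.

Lemma coset_rel_trans : transitive coset_rel.
Proof.
move=> y x z hx hz; have := group_closedM (nsub_closed N) hx hz.
by rewrite /coset_rel mulgA mulgK.
Qed.

Canonical coset_equiv :=
  EquivRel coset_rel coset_rel_refl coset_rel_sym coset_rel_trans.

Definition quotient_group := {eq_quot coset_equiv}.
HB.instance Definition _ := Choice.on quotient_group.
HB.instance Definition _ := Quotient.on quotient_group.
HB.instance Definition _ := EqQuotient.on quotient_group.

Definition coset x : quotient_group := \pi x.

Lemma cosetP x y : reflect (coset x = coset y) (x^-1 * y \in nsub N).
Proof. exact: (iffP (eqmodP coset_equiv x y)). Qed.

Definition quot_mul (u v : quotient_group) := coset (repr u * repr v).
Definition quot_one := coset 1.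
Definition quot_inv (u : quotient_group) := coset (repr u)^-1.

Lemma coset_repr u : coset (repr u) = u.
Proof. exact: reprK. Qed.

Lemma coset_ind (P : quotient_group -> Prop) :
  (forall x, P (coset x)) -> forall u, P u.
Proof. by move=> h u; rewrite -[u]coset_repr. Qed.

Lemma repr_coset x : x^-1 * repr (coset x) \in nsub N.
Proof. by apply/cosetP; rewrite coset_repr. Qed.

Lemma quot_mulE x y : quot_mul (coset x) (coset y) = coset (x * y).
Proof.
apply/esym/cosetP; set a := repr _; set b := repr _.
have -> : (x * y)^-1 * (a * b) = (x^-1 * a) ^ y * (y^-1 * b).
  by rewrite /conjg invgM !mulgA mulgK.
apply: (group_closedM (nsub_closed N)); last exact: repr_coset.
by apply: nsub_conj; exact: repr_coset.
Qed.

Lemma quot_invE x : quot_inv (coset x) = coset x^-1.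
Proof.
apply/esym/cosetP; set a := repr _; rewrite invgK.
have -> : x * a^-1 = ((x^-1 * a)^-1) ^ x^-1.
  by rewrite /conjg invgM !invgK !mulgA mulgK.
by apply/nsub_conj/(group_closedV (nsub_closed N))/repr_coset.
Qed.

Lemma quot_mulA : associative quot_mul.
Proof.
elim/coset_ind=> x; elim/coset_ind=> y; elim/coset_ind=> z.
by rewrite !quot_mulE mulgA.
Qed.

Lemma quot_mul1 : left_id quot_one quot_mul.
Proof. by elim/coset_ind=> x; rewrite quot_mulE mul1g. Qed.

Lemma quot_mul1r : right_id quot_one quot_mul.
Proof. by elim/coset_ind=> x; rewrite quot_mulE mulg1. Qed.

Lemma quot_mulV : left_inverse quot_one quot_inv quot_mul.
Proof. by elim/coset_ind=> x; rewrite quot_invE quot_mulE mulVg. Qed.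

Lemma quot_mulVr : right_inverse quot_one quot_inv quot_mul.
Proof. by elim/coset_ind=> x; rewrite quot_invE quot_mulE mulgV. Qed.

HB.instance Definition _ := isGroup.Build quotient_group
  quot_mulA quot_mul1 quot_mul1r quot_mulV quot_mulVr.

Lemma coset_is_mul : {morph coset : x y / x * y}.
Proof. by move=> x y; rewrite -quot_mulE. Qed.
HB.instance Definition _ := isMultiplicative.Build G quotient_group coset
  coset_is_mul.

End Quotient.

Section NormalClosure.
Variables (G : groupType) (A : G -> Prop).

Definition normal_closure_pred : pred G := fun x =>
  `[< forall N : normal_subgroup G, (forall a, A a -> a \in nsub N) ->
        x \in nsub N >].

Lemma normal_closure_closed : group_closed normal_closure_pred.
Proof.
split=> [|x y /asboolP hx /asboolP hy]; apply/asboolP=> N AN.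
  by case: (nsub_closed N).
by case: (nsub_closed N) => _; apply; [exact: hx | exact: hy].
Qed.

Lemma normal_closure_conj (x y : G) :
  x \in normal_closure_pred -> x ^ y \in normal_closure_pred.
Proof. by move=> /asboolP hx; apply/asboolP=> N AN; apply/nsub_conj/hx. Qed.

Definition normal_closure : normal_subgroup G :=
  NormalSubgroup normal_closure_closed normal_closure_conj.

End NormalClosure.

(* The letter (x, false) stands for the generator x and (x, true) for its
   inverse. *)
Section FreeGroup.
Variable X : choiceType.
Implicit Types u v w : seq (X * bool).

Inductive word_eq : seq (X * bool) -> seq (X * bool) -> Prop :=
| word_eq_refl w : word_eq w w
| word_eq_sym u v : word_eq u v -> word_eq v u
| word_eq_trans u v w : word_eq u v -> word_eq v w -> word_eq u w
| word_eq_cat u u' v v' :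
    word_eq u u' -> word_eq v v' -> word_eq (u ++ v) (u' ++ v')
| word_eq_cancel x b : word_eq [:: (x, b); (x, ~~ b)] [::].

Definition word_rel : rel (seq (X * bool)) := fun u v => `[< word_eq u v >].

Lemma word_rel_refl : reflexive word_rel.
Proof. by move=> u; apply/asboolP; constructor. Qed.

Lemma word_rel_sym : symmetric word_rel.
Proof. by move=> u v; apply/asboolP/asboolP; apply: word_eq_sym. Qed.

Lemma word_rel_trans : transitive word_rel.
Proof.
by move=> v u w /asboolP h /asboolP h'; apply/asboolP; apply: word_eq_trans h h'.
Qed.

Canonical word_equiv :=
  EquivRel word_rel word_rel_refl word_rel_sym word_rel_trans.

Definition free_group := {eq_quot word_equiv}.
HB.instance Definition _ := Choice.on free_group.
HB.instance Definition _ := Quotient.on free_group.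
HB.instance Definition _ := EqQuotient.on free_group.

Definition free_word w : free_group := \pi w.

Lemma free_wordP u v : free_word u = free_word v <-> word_eq u v.
Proof.
by split=> [/(eqmodP word_equiv)/asboolP|h] //; apply/(eqmodP word_equiv)/asboolP.
Qed.

Definition word_inv w := rev [seq (a.1, ~~ a.2) | a <- w].

Definition free_mul (g h : free_group) := free_word (repr g ++ repr h).
Definition free_one := free_word [::].
Definition free_inv (g : free_group) := free_word (word_inv (repr g)).

Lemma free_word_repr (g : free_group) : free_word (repr g) = g.
Proof. exact: reprK. Qed.

Lemma free_word_ind (P : free_group -> Prop) :
  (forall w, P (free_word w)) -> forall g, P g.
Proof. by move=> h g; rewrite -[g]free_word_repr. Qed.

Lemma repr_free_word w : word_eq w (repr (free_word w)).
Proof. by apply/free_wordP; rewrite free_word_repr. Qed.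

Lemma word_inv_eq u v : word_eq u v -> word_eq (word_inv u) (word_inv v).
Proof.
elim=> {u v} [w|u v _ h|u v w _ h _ h'|u u' v v' _ h _ h'|x b].
- exact: word_eq_refl.
- exact: word_eq_sym.
- exact: word_eq_trans h h'.
- by rewrite /word_inv !map_cat !rev_cat; apply: word_eq_cat.
- by rewrite /word_inv /rev /= negbK; apply: word_eq_cancel.
Qed.

Lemma word_mulV w : word_eq (w ++ word_inv w) [::].
Proof.
elim: w => [|[x b] w IH]; first exact: word_eq_refl.
have -> : ((x, b) :: w) ++ word_inv ((x, b) :: w) =
    [:: (x, b)] ++ ((w ++ word_inv w) ++ [:: (x, ~~ b)]).
  by rewrite /word_inv /= rev_cons -cats1 catA.
apply: word_eq_trans (word_eq_cancel x b).
apply: (@word_eq_cat _ [:: (x, b)] _ [:: (x, ~~ b)]); first exact: word_eq_refl.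
rewrite -[X in word_eq _ X]cat0s.
by apply: word_eq_cat => //; exact: word_eq_refl.
Qed.

Lemma word_invK w : word_inv (word_inv w) = w.
Proof.
rewrite /word_inv map_rev revK -map_comp -[RHS]map_id; apply: eq_map.
by case=> x b /=; rewrite negbK.
Qed.

Lemma free_mulE u v : free_mul (free_word u) (free_word v) = free_word (u ++ v).
Proof. by apply/esym/free_wordP/word_eq_cat; exact: repr_free_word. Qed.

Lemma free_invE u : free_inv (free_word u) = free_word (word_inv u).
Proof. by apply/esym/free_wordP/word_inv_eq; exact: repr_free_word. Qed.

Lemma free_mulA : associative free_mul.
Proof.
elim/free_word_ind=> u; elim/free_word_ind=> v; elim/free_word_ind=> w.
by rewrite !free_mulE catA.
Qed.

Lemma free_mul1 : left_id free_one free_mul.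
Proof. by elim/free_word_ind=> w; rewrite free_mulE. Qed.

Lemma free_mul1r : right_id free_one free_mul.
Proof. by elim/free_word_ind=> w; rewrite free_mulE cats0. Qed.

Lemma free_mulVr : right_inverse free_one free_inv free_mul.
Proof.
elim/free_word_ind=> w; rewrite free_invE free_mulE.
by apply/free_wordP; exact: word_mulV.
Qed.

Lemma free_mulV : left_inverse free_one free_inv free_mul.
Proof.
elim/free_word_ind=> w; rewrite free_invE free_mulE.
by apply/free_wordP; rewrite -{2}[w]word_invK; exact: word_mulV.
Qed.

HB.instance Definition _ := isGroup.Build free_group
  free_mulA free_mul1 free_mul1r free_mulV free_mulVr.

Definition free_gen (x : X) : free_group := free_word [:: (x, false)].

End FreeGroup.

(* The group < X | u = v for all u, v such that R u v >. *)
Section Presentation.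
Variables (X : choiceType) (R : free_group X -> free_group X -> Prop).

Definition presented_group :=
  quotient_group (normal_closure (fun w => exists u v, R u v /\ w = u * v^-1)).
HB.instance Definition _ := Group.on presented_group.

Definition pgen (x : X) : presented_group := coset _ (free_gen x).

End Presentation.

(* The group of all permutations of T, with product f * g = f \o g. *)
Section Permutations.
Variable T : choiceType.

Record permutation := Permutation { pfun :> T -> T; _ : `[< bijective pfun >] }.

HB.instance Definition _ := [isSub for pfun].
HB.instance Definition _ := [Choice of permutation by <:].
Implicit Types f g h : permutation.

Lemma permutation_bij f : bijective f.
Proof. exact: (asboolW (valP f)). Qed.

Lemma permutation_eq f g : f =1 g -> f = g.
Proof. by move=> h; apply: val_inj; exact/funext. Qed.

Definition perm_of (f : T -> T) (hf : bijective f) : permutation :=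
  Permutation (asboolT hf).

Definition permutation_one : permutation :=
  perm_of (@Bijective _ _ id id (@frefl T T id) (@frefl T T id)).

Definition permutation_mul f g : permutation :=
  perm_of (bij_comp (permutation_bij f) (permutation_bij g)).

Lemma permutation_inv_ex f : exists g : permutation, cancel g f /\ cancel f g.
Proof.
by case: (permutation_bij f) => g fK gK; exists (perm_of (Bijective gK fK)).
Qed.

Definition permutation_inv f : permutation := sval (cid (permutation_inv_ex f)).

Lemma permutation_mulA : associative permutation_mul.
Proof. by move=> f g h; exact: permutation_eq. Qed.

Lemma permutation_mul1 : left_id permutation_one permutation_mul.
Proof. by move=> f; exact: permutation_eq. Qed.

Lemma permutation_mul1r : right_id permutation_one permutation_mul.
Proof. by move=> f; exact: permutation_eq. Qed.

Lemma permutation_mulV :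
  left_inverse permutation_one permutation_inv permutation_mul.
Proof.
move=> f; apply: permutation_eq; rewrite /permutation_inv.
by case: cid => g [fK gK] x /=; exact: gK.
Qed.

Lemma permutation_mulVr :
  right_inverse permutation_one permutation_inv permutation_mul.
Proof.
move=> f; apply: permutation_eq; rewrite /permutation_inv.
by case: cid => g [fK gK] x /=; exact: fK.
Qed.

HB.instance Definition _ := isGroup.Build permutation permutation_mulA
  permutation_mul1 permutation_mul1r permutation_mulV permutation_mulVr.

End Permutations.


(* A tableau is the list of its rows, from top to bottom; rows and columns are
   indexed from 0. *)
Section Tableaux.
Local Open Scope nat_scope.
Implicit Types (T : seq (seq nat)) (i r c : nat).

Definition is_partition (mu : seq nat) : bool := sorted geq mu && (0 \notin mu).

Definition strictly_above (row row' : seq nat) : bool :=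
  all2 ltn (take (size row') row) row'.

Definition is_ssyt (N : nat) T : bool :=
  [&& is_partition (shape T), all (all (fun x => 0 < x <= N)) T,
      all (sorted leq) T & sorted strictly_above T].

Definition cell T r c : bool := c < size (nth [::] T r).
Definition entry T r c : nat := nth 0 (nth [::] T r) c.

(* Padded with 0, which is not an entry, where the column has no cell. *)
Definition column T c : seq nat := [seq nth 0 row c | row <- T].

Definition is_free i T r c : bool :=
  ((entry T r c == i) || (entry T r c == i.+1)) &&
  ~~ ((i \in column T c) && (i.+1 \in column T c)).

(* If the row r has k free entries i followed by l free entries i + 1, then its
   l leftmost free cells receive i and the others receive i + 1. *)
Definition bk_entry i T r c : nat :=
  if is_free i T r c then
    let l := count (fun d => is_free i T r d && (entry T r d == i.+1))
               (iota 0 (size (nth [::] T r))) in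
    if count (is_free i T r) (iota 0 c) < l then i else i.+1
  else entry T r c.

Definition bk i T : seq (seq nat) :=
  mkseq (fun r => mkseq (bk_entry i T r) (size (nth [::] T r))) (size T).

Lemma shape_bk i T : shape (bk i T) = shape T.
Proof.
apply: (@eq_from_nth _ 0) => [|r]; rewrite !size_map ?size_iota // => hr.
by rewrite !(nth_map [::]) ?size_mkseq ?nth_mkseq // size_mkseq.
Qed.

Lemma size_bk_row i T r : size (nth [::] (bk i T) r) = size (nth [::] T r).
Proof.
case: (ltnP r (size T)) => hr; first by rewrite nth_mkseq // size_mkseq.
by rewrite !nth_default // size_mkseq.
Qed.

Lemma cell_bk i T r c : cell (bk i T) r c = cell T r c.
Proof. by rewrite /cell size_bk_row. Qed.

Lemma cell_row T r c : cell T r c -> r < size T.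
Proof. by rewrite /cell; case: (ltnP r) => // h; rewrite nth_default. Qed.

Lemma entry_bk i T r c : cell T r c -> entry (bk i T) r c = bk_entry i T r c.
Proof.
by move=> h; have hr := cell_row h; rewrite /entry nth_mkseq // nth_mkseq.
Qed.

Definition ssyt_axioms N T : Prop :=
  [/\ is_partition (shape T),
      forall r c, cell T r c -> 0 < entry T r c <= N,
      forall r c, cell T r c.+1 -> entry T r c <= entry T r c.+1
    & forall r c, cell T r.+1 c -> entry T r c < entry T r.+1 c].

Lemma cell_up T r c : is_partition (shape T) -> cell T r.+1 c -> cell T r c.
Proof.
move=> /andP[/(sortedP 0) hs _] h; have hr := cell_row h; rewrite /shape in hs.
have := hs r; rewrite size_map => /(_ hr).
rewrite !(nth_map [::]) //; last exact: ltnW.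
exact: leq_trans h.
Qed.

Lemma ssytP N T : reflect (ssyt_axioms N T) (is_ssyt N T).
Proof.
apply: (iffP and4P) => -[hp hb hr hc]; split => //.
- move=> r c h; have /(all_nthP [::])/(_ r (cell_row h)) := hb.
  by move=> /(all_nthP 0)/(_ c h).
- move=> r c h; have /(all_nthP [::])/(_ r (cell_row h)) := hr.
  by move=> /(sortedP 0)/(_ c h).
- move=> r c h; have /(sortedP [::])/(_ r (cell_row h)) := hc.
  rewrite /strictly_above all2E => /andP[/eqP es /(all_nthP (0, 0))/(_ c)].
  rewrite size_zip es minnn => /(_ h); rewrite nth_zip //= nth_take //.
- apply/(all_nthP [::]) => r _; apply/(all_nthP 0) => c h; exact: hb.
- apply/(all_nthP [::]) => r _; apply/(sortedP 0) => c h; exact: hr.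
apply/(sortedP [::]) => r hrT; rewrite /strictly_above all2E.
have es : size (take (size (nth [::] T r.+1)) (nth [::] T r)) =
          size (nth [::] T r.+1).
  apply: size_takel; rewrite leqNgt; apply/negP => h.
  by have := @cell_up T r _ hp h; rewrite /cell ltnn.
rewrite es eqxx /=; apply/(all_nthP (0, 0)) => c.
by rewrite size_zip es minnn => h; rewrite nth_zip //= nth_take //; apply: hc.
Qed.

Section BenderKnuth.
Variables (N : nat) (T : seq (seq nat)).
Hypothesis HT : ssyt_axioms N T.

Lemma cell_le r r' c c' : r <= r' -> c <= c' -> cell T r' c' -> cell T r c.
Proof.
case: HT => hp _ _ _ hr hc h.
have {h hc} : cell T r' c by exact: leq_ltn_trans hc h.
elim: r' hr => [|r' IH]; first by rewrite leqn0 => /eqP ->.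
by rewrite leq_eqVlt => /predU1P[-> //|hr] /(cell_up hp); exact: IH.
Qed.

Lemma entry_row r c c' : c <= c' -> cell T r c' -> entry T r c <= entry T r c'.
Proof.
case: HT => _ _ hrow _; elim: c' => [|c' IH]; first by rewrite leqn0 => /eqP ->.
rewrite leq_eqVlt => /predU1P[-> //|hc] h.
apply: leq_trans (hrow _ _ h); apply: IH => //.
by apply: cell_le h.
Qed.

Lemma entry_col r r' c : r < r' -> cell T r' c -> entry T r c < entry T r' c.
Proof.
case: HT => _ _ _ hcol; elim: r' => [//|r' IH].
rewrite ltnS leq_eqVlt => /predU1P[-> | hr] h; first exact: hcol.
apply: ltn_trans (hcol _ _ h); apply: IH => //.
by apply: cell_le h.
Qed.

Lemma columnP x c : 0 < x ->
  reflect (exists2 r, cell T r c & entry T r c = x) (x \in column T c).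
Proof.
rewrite /column => x0; apply: (iffP (nthP 0)) => -[r]; rewrite ?size_map => hr e.
  rewrite (nth_map [::]) // in e; exists r => //.
  by rewrite /cell ltnNge; apply/negP => /(nth_default 0) h; rewrite -e h in x0.
have hT := cell_row hr; exists r => //.
by rewrite (nth_map [::]).
Qed.

End BenderKnuth.

Section BenderKnuthStep.
Variables (N i : nat) (T : seq (seq nat)).
Hypotheses (i_gt0 : 0 < i) (i_ltN : i < N) (HT : ssyt_axioms N T).

Lemma bk_free_entry r c : is_free i T r c ->
  (bk_entry i T r c == i) || (bk_entry i T r c == i.+1).
Proof. by move=> h; rewrite /bk_entry h; case: ifP; rewrite eqxx ?orbT. Qed.

Lemma bk_fixed_entry r c : ~~ is_free i T r c -> bk_entry i T r c = entry T r c.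
Proof. by rewrite /bk_entry => /negbTE ->. Qed.

Lemma fixed_left r c d : c <= d -> cell T r d ->
  entry T r c = i -> entry T r d = i -> ~~ is_free i T r d -> ~~ is_free i T r c.
Proof.
move=> cd hd ec ed; rewrite /is_free ec ed eqxx /= !negbK.
case/andP=> _ /(columnP T d (ltn0Sn i))[r' hr' er'].
apply/andP; split; first by apply/(columnP T c i_gt0); exists r; rewrite ?(cell_le HT _ cd hd).
apply/(columnP T c (ltn0Sn i)); exists r'; first exact: (cell_le HT _ cd hr').
have rr' : r < r'.
  rewrite ltnNge; apply/negP; rewrite leq_eqVlt => /predU1P[e|h].
    by move: er'; rewrite e ed => /n_Sn.
  by have := entry_col HT h hd; rewrite ed er' ltnNge leqnSn.
have := entry_col HT rr' (cell_le HT (leqnn _) cd hr').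
have := entry_row HT cd hr'; rewrite ec er' => h1 h2.
by apply/eqP; rewrite eqn_leq h1.
Qed.

Lemma fixed_right r c d : c <= d -> cell T r d ->
  entry T r c = i.+1 -> entry T r d = i.+1 ->
  ~~ is_free i T r c -> ~~ is_free i T r d.
Proof.
move=> cd hd ec ed; rewrite /is_free ec ed eqxx orbT /= !negbK.
case/andP=> /(columnP T c i_gt0)[r' hr' er'] _.
have hc := cell_le HT (leqnn r) cd hd.
have rr' : r' < r.
  rewrite ltnNge; apply/negP; rewrite leq_eqVlt => /predU1P[e|h].
    by move: er'; rewrite -e ec => /esym/n_Sn.
  by have := entry_col HT h hr'; rewrite ec er' ltnNge leqnSn.
have hd' := cell_le HT (ltnW rr') (leqnn d) hd.
apply/andP; split; last by apply/(columnP T d (ltn0Sn i)); exists r.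
apply/(columnP T d i_gt0); exists r' => //.
have := entry_col HT rr' hd; rewrite ed ltnS => h1.
have := entry_row HT cd hd'; rewrite er' => h2.
by apply/eqP; rewrite eqn_leq h1.
Qed.

Lemma bk_entry_le r c : is_free i T r c -> bk_entry i T r c <= i.+1.
Proof. by move/bk_free_entry => /orP[]/eqP ->. Qed.

Lemma bk_entry_ge r c : is_free i T r c -> i <= bk_entry i T r c.
Proof. by move/bk_free_entry => /orP[]/eqP ->. Qed.

Lemma free_entry r c : is_free i T r c -> i <= entry T r c <= i.+1.
Proof. by case/andP=> /orP[]/eqP -> _; rewrite leqnn leqnSn. Qed.

Lemma bk_row r c d : c <= d -> cell T r d -> bk_entry i T r c <= bk_entry i T r d.
Proof.
move=> cd hd; have le := entry_row HT cd hd.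
have [fc|fc] := boolP (is_free i T r c); have [fd|fd] := boolP (is_free i T r d).
- have h : count (is_free i T r) (iota 0 c) <= count (is_free i T r) (iota 0 d).
    by rewrite -(subnKC cd) iotaD count_cat leq_addr.
  by rewrite /bk_entry fc fd; case: ifP => hc; case: ifP => hd' //;
    rewrite (leq_ltn_trans h hd') in hc.
- rewrite (bk_fixed_entry fd); have /andP[h1 _] := free_entry fc.
  have h2 := bk_entry_le fc; have := leq_trans h1 le.
  rewrite leq_eqVlt => /predU1P[e|]; last exact: leq_trans h2.
  have ec : entry T r c = i by apply/eqP; rewrite eqn_leq h1 e le.
  by have := fixed_left cd hd ec (esym e) fd; rewrite fc.
- rewrite (bk_fixed_entry fc); have /andP[_ h1] := free_entry fd.
  have h2 := bk_entry_ge fd; have := leq_trans le h1.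
  rewrite leq_eqVlt => /predU1P[e|]; last first.
    by rewrite ltnS => h; exact: leq_trans h2.
  have ed : entry T r d = i.+1 by apply/eqP; rewrite eqn_leq h1 -e le.
  by have := fixed_right cd hd e ed fc; rewrite fd.
- by rewrite !bk_fixed_entry.
Qed.

Lemma bk_col r c : cell T r.+1 c -> bk_entry i T r c < bk_entry i T r.+1 c.
Proof.
move=> h; have hr := cell_le HT (leqnSn r) (leqnn c) h.
have lt := entry_col HT (ltnSn r) h.
have [fr|fr] := boolP (is_free i T r c); have [fs|fs] := boolP (is_free i T r.+1 c).
- have /andP[h1 h1'] := free_entry fr; have /andP[h2 h2'] := free_entry fs.
  have er : entry T r c = i.
    by apply/eqP; rewrite eqn_leq h1 -ltnS (leq_trans lt).
  have es : entry T r.+1 c = i.+1.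
    by apply/eqP; rewrite eqn_leq h2' (leq_ltn_trans h1).
  case/andP: fr => _ /negP[]; apply/andP; split; apply/columnP => //.
    by exists r.
  by exists r.+1.
- rewrite (bk_fixed_entry fs) (leq_ltn_trans (bk_entry_le fr)) //.
  have /andP[h1 h1'] := free_entry fr.
  have : i.+1 <= entry T r.+1 c by exact: leq_ltn_trans h1 lt.
  rewrite leq_eqVlt => /predU1P[e|//].
  have er : entry T r c = i by apply/eqP; rewrite eqn_leq h1 -ltnS e lt.
  case/andP: fr => _ /negP[]; apply/andP; split; apply/columnP => //.
    by exists r.
  by exists r.+1.
- rewrite (bk_fixed_entry fr) (leq_trans _ (bk_entry_ge fs)) //.
  have /andP[h1 h1'] := free_entry fs.
  have : entry T r c <= i by rewrite -ltnS (leq_trans lt).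
  rewrite leq_eqVlt => /predU1P[e|//].
  have es : entry T r.+1 c = i.+1 by apply/eqP; rewrite eqn_leq h1' -e lt.
  case/andP: fs => _ /negP[]; apply/andP; split; apply/columnP => //.
    by exists r.
  by exists r.+1.
- by rewrite !bk_fixed_entry.
Qed.

Lemma bk_ssyt_axioms : ssyt_axioms N (bk i T).
Proof.
case: (HT) => hp hb _ _; split; first by rewrite shape_bk.
- move=> r c; rewrite cell_bk => h; rewrite entry_bk //.
  have [f|f] := boolP (is_free i T r c); last by rewrite bk_fixed_entry ?hb.
  rewrite (leq_trans i_gt0 (bk_entry_ge f)).
  exact: leq_trans (bk_entry_le f) i_ltN.
- move=> r c; rewrite cell_bk => h; rewrite !entry_bk //; first exact: bk_row.
  exact: (cell_le HT (leqnn r) (leqnSn c) h).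
- move=> r c; rewrite cell_bk => h; rewrite !entry_bk //; first exact: bk_col.
  exact: (cell_le HT (leqnSn r) (leqnn c) h).
Qed.

(* Both i and i + 1 occur in a column of bk i T exactly if they do in T. *)
Lemma column_bk c : (i \in column (bk i T) c) && (i.+1 \in column (bk i T) c) =
                    (i \in column T c) && (i.+1 \in column T c).
Proof.
apply/idP/idP=> /andP[]/(columnP _ _ i_gt0)[r hr er]
    /(columnP _ _ (ltn0Sn i))[s hs es]; last first.
  have both : (i \in column T c) && (i.+1 \in column T c).
    by apply/andP; split; apply/columnP => //; [exists r | exists s].
  apply/andP; split; apply/columnP => //; [exists r | exists s];
    by rewrite ?cell_bk // entry_bk // bk_fixed_entry // /is_free both andbF.
have hr' := hr; have hs' := hs; rewrite cell_bk in hr'; rewrite cell_bk in hs'.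
rewrite entry_bk // in er; rewrite entry_bk // in es.
apply: contraT => both.
have rs : r != s by apply/eqP => e; move: es; rewrite -e er => /n_Sn.
have in_free t : cell T t c -> (bk_entry i T t c == i) || (bk_entry i T t c == i.+1) ->
    (entry T t c == i) || (entry T t c == i.+1).
  move=> ht; have [/andP[] //|f] := boolP (is_free i T t c).
  by rewrite bk_fixed_entry.
have := in_free r hr'; rewrite er eqxx => /(_ isT) hir.
have := in_free s hs'; rewrite es eqxx orbT => /(_ isT) his.
move/negP: both; case; apply/andP.
have ne : entry T r c != entry T s c.
  move: rs; rewrite neq_ltn => /orP[]h; rewrite neq_ltn (entry_col HT h) ?orbT //.
by case/orP: hir => /eqP e1; case/orP: his => /eqP e2; rewrite e1 e2 ?eqxx // in ne;
  split; apply/columnP => //; by [exists r | exists s].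
Qed.

Lemma is_free_bk r c : cell T r c -> is_free i (bk i T) r c = is_free i T r c.
Proof.
move=> h; have [f|f] := boolP (is_free i T r c).
  rewrite /is_free column_bk entry_bk // bk_free_entry //.
  by case/andP: f.
apply/negP; rewrite /is_free column_bk entry_bk // bk_fixed_entry //.
by apply/negP.
Qed.

(* The free entries of a row being weakly increasing, those equal to i come
   first. *)
Lemma free_rank r c : cell T r c -> is_free i T r c ->
  (count (is_free i T r) (iota 0 c) <
   count (fun d => is_free i T r d && (entry T r d == i))
     (iota 0 (size (nth [::] T r)))) = (entry T r c == i).
Proof.
move=> h f; set m := size _.
have hm : c < m by [].
have em : iota 0 m = iota 0 c ++ c :: iota c.+1 (m - c.+1).
  by rewrite -[c :: _]/(iota c (m - c.+1).+1) -subSn // subSS -iotaD subnKC // ltnW.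
rewrite em count_cat /= f /=.
have [e|e] := eqVneq (entry T r c) i.
  have -> : count (fun d => is_free i T r d && (entry T r d == i)) (iota 0 c) =
            count (is_free i T r) (iota 0 c).
    apply: eq_in_count => d; rewrite mem_iota add0n => /andP[_ dc].
    have [fd|//] := boolP (is_free i T r d); rewrite /=.
    have /andP[h1 _] := free_entry fd.
    by rewrite eqn_leq h1 -{1}e (entry_row HT (ltnW dc) h).
  by rewrite add1n addnS ltnS leq_addr.
have e' : entry T r c = i.+1 by case/andP: f => /orP[]/eqP // e'; rewrite e' eqxx in e.
have -> : count (fun d => is_free i T r d && (entry T r d == i))
    (iota c.+1 (m - c.+1)) = 0.
  apply/eqP; rewrite -leqn0 leqNgt -has_count; apply/hasPn => d.
  rewrite mem_iota subnKC // => /andP[cd dm].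
  apply/negP => /andP[_ /eqP ed].
  by have := entry_row HT (ltnW cd) dm; rewrite ed e' ltnn.
rewrite !addn0; apply/negbTE; rewrite -leqNgt.
by apply: sub_count => d /andP[].
Qed.

Lemma count_rank (P : pred nat) l m :
  count (fun d => P d && (count P (iota 0 d) < l)) (iota 0 m) =
  minn l (count P (iota 0 m)).
Proof.
elim: m => [|m IH]; first by rewrite minn0.
rewrite -addn1 iotaD !count_cat IH add0n /= !addn0.
case: (P m) => /=; last by rewrite !addn0.
by case: ltnP => h; rewrite ?addn0; apply/esym;
  [apply/minn_idPr; rewrite addn1 | apply/minn_idPl/(leq_trans h)/leq_addr].
Qed.

Lemma bk_count r (s := iota 0 (size (nth [::] T r))) :
  count (fun d => is_free i T r d && (bk_entry i T r d == i.+1)) s =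
  count (fun d => is_free i T r d && (entry T r d == i)) s.
Proof.
pose l := count (fun d => is_free i T r d && (entry T r d == i.+1)) s.
pose P d := is_free i T r d.
apply/eqP; rewrite -(eqn_add2l l); apply/eqP.
have -> : l + count (fun d => P d && (entry T r d == i)) s = count P s.
  rewrite addnC -count_predUI -[RHS]addn0; congr (_ + _).
    apply: eq_count => d /=; rewrite -andb_orr /P.
    by have [/andP[-> _]|//] := boolP (is_free i T r d).
  apply/eqP; rewrite -leqn0 leqNgt -has_count; apply/hasPn => d _ /=.
  apply/negP => /andP[/andP[_ /eqP ->] /andP[_ /eqP]]; exact/n_Sn.
have {1}-> : l = count (fun d => P d && (count P (iota 0 d) < l)) s.
  rewrite count_rank; apply/esym/minn_idPl/sub_count => d; by case/andP.
rewrite -count_predUI -[RHS]addn0; congr (_ + _).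
  apply: eq_count => d /=; rewrite -andb_orr /bk_entry -/s -/l /P.
  case: (is_free i T r d) => //=; case: ifP => _ //=; exact: eqxx.
apply/eqP; rewrite -leqn0 leqNgt -has_count; apply/hasPn => d _ /=.
rewrite /bk_entry -/s -/l /P; case: (is_free i T r d) => //=.
by case: ifP => //= _; apply/eqP/n_Sn.
Qed.

Lemma bk_bk : bk i (bk i T) = T.
Proof.
apply: (@eq_from_nth _ [::]); first by rewrite !size_mkseq.
move=> r; rewrite !size_mkseq => hr.
apply: (@eq_from_nth _ 0); first by rewrite !size_bk_row.
move=> c; rewrite !size_bk_row => h.
rewrite -/(entry (bk i (bk i T)) r c) -/(entry T r c) entry_bk ?cell_bk //.
have [f|f] := boolP (is_free i T r c); last first.
  by rewrite {1}/bk_entry is_free_bk // (negbTE f) entry_bk // bk_fixed_entry.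
rewrite {1}/bk_entry is_free_bk // f size_bk_row.
set m := size _.
have -> : count (is_free i (bk i T) r) (iota 0 c) = count (is_free i T r) (iota 0 c).
  apply: eq_in_count => d; rewrite mem_iota add0n => /andP[_ dc].
  by apply: is_free_bk; apply: ltn_trans dc h.
set l := count _ (iota 0 m).
suff -> : l = count (fun d => is_free i T r d && (entry T r d == i)) (iota 0 m).
  rewrite free_rank //; case: eqP => // /eqP e.
  by case/andP: f => /orP[]/eqP // e'; rewrite e' eqxx in e.
have -> : l = count (fun d => is_free i T r d && (bk_entry i T r d == i.+1)) (iota 0 m).
  apply: eq_in_count => d; rewrite mem_iota add0n => /andP[_ dm].
  by rewrite is_free_bk // entry_bk.
exact: bk_count.
Qed.

End BenderKnuthStep.

(* The disjoint union over all partitions mu of SSYT(mu, N). *)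
Record ssyt (N : nat) := SSYT { tableau :> seq (seq nat); _ : is_ssyt N tableau }.

HB.instance Definition _ N := [isSub for @tableau N].
HB.instance Definition _ N := [Choice of ssyt N by <:].

Lemma bk_ssyt N i (T : ssyt N) :
  is_ssyt N (if 0 < i < N then bk i T else T).
Proof.
have HT := valP T; case: ifP => // /andP[i0 iN].
by apply/ssytP; apply: bk_ssyt_axioms => //; exact/ssytP.
Qed.

(* t_i for 1 <= i < N; the identity for the other values of i. *)
Definition bk_move N i (T : ssyt N) : ssyt N := SSYT (bk_ssyt i T).

Lemma bk_moveK N i : involutive (@bk_move N i).
Proof.
move=> T; apply: val_inj; rewrite /=; have [h|//] := boolP (0 < i < N).
by case/andP: h => i0 iN; apply: (@bk_bk N) => //; exact/ssytP/(valP T).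
Qed.

End Tableaux.

Section BerensteinKirillov.
Variable n : nat.

Definition bk_perm (i : nat) : permutation (ssyt n.*2) :=
  perm_of (inv_bij (@bk_moveK n.*2 i)).

Definition is_bk_generator (g : permutation (ssyt n.*2)) : Prop :=
  exists2 i, (0 < i < n.*2)%N & g = bk_perm i.

Definition BK := gen_group is_bk_generator.
HB.instance Definition _ := Group.on BK.

Lemma bk_perm_generated i : generated is_bk_generator (bk_perm i).
Proof.
have [h|h] := boolP (0 < i < n.*2)%N; first by apply: generated_sub; exists i.
have -> : bk_perm i = 1.
  by apply: permutation_eq => T; apply: val_inj; rewrite /= (negbTE h).
by have [] := generated_closed is_bk_generator.
Qed.

Definition bk_t (i : nat) : BK := GenGroup (bk_perm_generated i).

(* q_[1,i] = t_1 (t_2 t_1) ... (t_i t_(i-1) ... t_1) *)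
Definition bk_q1 (i : nat) : BK :=
  \prod_(1 <= a < i.+1) \prod_(1 <= b < a.+1) bk_t (a.+1 - b).

(* q_[j,k-1] = q_[1,k-1] q_[1,k-j] q_[1,k-1], with m = k - 1 *)
Definition bk_q (j m : nat) : BK := bk_q1 m * bk_q1 (m.+1 - j) * bk_q1 m.

Definition bk_q_pair (i : nat) : BK := bk_q1 i * bk_q (n.*2 - i) (n.*2 - 1)%N.

Definition is_vbk_generator (g : BK) : Prop :=
  (exists2 i, (1 <= i < n)%N & g = bk_q_pair i) \/
  (exists2 i, (1 <= i <= n)%N & g = bk_q i (n.*2 - i)).

Definition VBK := gen_group is_vbk_generator.
HB.instance Definition _ := Group.on VBK.

End BerensteinKirillov.

(* The nodes 1, ..., m of a Dynkin diagram of type A_m or C_m are elements of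
   'I_m.+1, where 0 is not a node; consecutive nodes are adjacent. *)
Definition itv (m p q : nat) : {set 'I_m.+1} := [set i : 'I_m.+1 | p <= i <= q].

(* No node of J is equal or adjacent to a node of J'. *)
Definition disconnected m (J J' : {set 'I_m.+1}) : bool :=
  [forall i in J, forall j in J', (i.+1 < j)%N || (j.+1 < i)%N].

Section Cactus.
Variable n : nat.
Local Open Scope nat_scope.

Definition is_sp_diagram (J : {set 'I_n.+1}) : bool :=
  [exists p : 'I_n.+1, exists q : 'I_n.+1, (0 < p <= q) && (J == itv n p q)].

Record sp_diagram := SpDiagram
  { sp_nodes :> {set 'I_n.+1}; _ : is_sp_diagram sp_nodes }.
HB.instance Definition _ := [isSub for sp_nodes].
HB.instance Definition _ := [Choice of sp_diagram by <:].

Local Notation s := (@free_gen sp_diagram).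

Inductive sp_relation :
    free_group sp_diagram -> free_group sp_diagram -> Prop :=
| sp_square (J : sp_diagram) : sp_relation (s J * s J)%g 1%g
| sp_disconnected (J J' : sp_diagram) :
    disconnected J J' -> sp_relation (s J * s J')%g (s J' * s J)%g
| sp_commute (p k l : nat) (J J' : sp_diagram) :
    0 < p -> p <= k -> k <= l -> l <= n ->
    sp_nodes J = itv n p n -> sp_nodes J' = itv n k l ->
    sp_relation (s J * s J')%g (s J' * s J)%g
| sp_reverse (p q k l : nat) (J J' J'' : sp_diagram) :
    0 < p -> p <= k -> k <= l -> l <= q -> q < n ->
    sp_nodes J = itv n p q -> sp_nodes J' = itv n k l ->
    sp_nodes J'' = itv n (p + q - l) (p + q - k) ->
    sp_relation (s J * s J')%g (s J'' * s J)%g.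

Definition sp_cactus := presented_group sp_relation.
HB.instance Definition _ := Group.on sp_cactus.

(* vpair p q is [p,q] u [2n-q,2n-p], hence equal to vmid p when q = n. *)
Definition vmid (p : nat) := itv n.*2.-1 p (n.*2 - p).
Definition vpair (p q : nat) :=
  itv n.*2.-1 p q :|: itv n.*2.-1 (n.*2 - q) (n.*2 - p).

Definition is_v_diagram (J : {set 'I_n.*2.-1.+1}) : bool :=
  [exists p : 'I_n.+1, (0 < p) && (J == vmid p)] ||
  [exists p : 'I_n.+1, exists q : 'I_n.+1,
     [&& 0 < p, p <= q, q < n & J == vpair p q]].

Record v_diagram := VDiagram
  { v_nodes :> {set 'I_n.*2.-1.+1}; _ : is_v_diagram v_nodes }.
HB.instance Definition _ := [isSub for v_nodes].
HB.instance Definition _ := [Choice of v_diagram by <:].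

Local Notation vs := (@free_gen v_diagram).

Inductive v_relation : free_group v_diagram -> free_group v_diagram -> Prop :=
| v_square (J : v_diagram) : v_relation (vs J * vs J)%g 1%g
| v_disconnected (J J' : v_diagram) :
    disconnected J J' -> v_relation (vs J * vs J')%g (vs J' * vs J)%g
| v_commute (p q l : nat) (J J' : v_diagram) :
    0 < p -> p <= q -> q <= l -> l <= n ->
    v_nodes J = vmid p -> v_nodes J' = vpair q l ->
    v_relation (vs J * vs J')%g (vs J' * vs J)%g
| v_reverse (p q k l : nat) (J J' J'' : v_diagram) :
    0 < p -> p <= k -> k <= l -> l <= q -> q < n ->
    v_nodes J = vpair p q -> v_nodes J' = vpair k l ->
    v_nodes J'' = vpair (p + q - l) (p + q - k) ->
    v_relation (vs J * vs J')%g (vs J'' * vs J)%g.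

Definition v_cactus := presented_group v_relation.
HB.instance Definition _ := Group.on v_cactus.

Definition sp_gen (J : sp_diagram) : sp_cactus := pgen sp_relation J.
Definition v_gen (J : v_diagram) : v_cactus := pgen v_relation J.

Definition v_to_bk_assignment (psi : v_cactus -> VBK n) : Prop :=
  (forall (j : nat) (J : v_diagram), 1 <= j < n -> v_nodes J = vpair 1 j ->
     gval (psi (v_gen J)) = bk_q_pair n j) /\
  (forall (j : nat) (J : v_diagram), 1 <= j <= n -> v_nodes J = vmid j ->
     gval (psi (v_gen J)) = bk_q n j (n.*2 - j)).

Definition sp_to_v_assignment (phi : sp_cactus -> v_cactus) : Prop :=
  (forall (j : nat) (I : sp_diagram) (J : v_diagram), 1 <= j < n ->
     sp_nodes I = itv n 1 j -> v_nodes J = vpair 1 j ->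
     phi (sp_gen I) = v_gen J) /\
  (forall (j : nat) (I : sp_diagram) (J : v_diagram), 1 <= j <= n ->
     sp_nodes I = itv n j n -> v_nodes J = vmid j ->
     phi (sp_gen I) = v_gen J).

End Cactus.

(* Main.v *)
Require Import Defs.
From HB Require Import structures.
From mathcomp Require Import all_boot boolp.
From mathcomp Require Import all_order all_algebra zify.
From Stdlib Require Import Relation_Operators.
Set Implicit Arguments.
Unset Strict Implicit.
Unset Printing Implicit Defensive.
Import Order.TTheory GRing.Theory Num.Theory.

(** Folding the diagram of type A_(2n-1) along i |-> 2n - i turns the interval
    [p,q] of [1,n] into [p,q] u [2n-q,2n-p] (which is [p,2n-p] when q = n), and
    turns the generators and relations of J_sp(2n) into those of the virtual
    cactus group.  Both groups are therefore universal among groups with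
    elements c p q, 1 <= p <= q <= n, subject to the same four relations
    ([symplectic_family], [sp_ext], [v_ext]); the isomorphism [phi] follows at
    once, and [psi] exists as soon as the elements q_[p,q] q_[2n-q,2n-p] and
    q_[p,2n-p] satisfy these relations ([folded_family]).  Uniqueness holds
    because c p q is a word in the c 1 j and c j n ([family_conj]), and the
    quotients are those by the kernels of [psi] and of [psi] after [phi].

    The relations for the folded elements follow from the cactus relations of
    type A for the q_[p,q] in the Berenstein-Kirillov group.  That each q_[p,q]
    is an involution and reverses the intervals that it contains is formal: it
    only uses t_i^2 = 1 and t_i t_j = t_j t_i for |i - j| > 1 ([evac_evac],
    [evac_itv_conj]).  That separated intervals commute is not: it amounts to
    t_i q_[j,m] = q_[j,m] t_i for i + 1 < j ([evac_itv_toggle]), a statement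
    about tableaux.

    To prove it, a tableau is recorded by its Gelfand-Tsetlin pattern, whose
    entry (i, r) counts the entries at most i in the row r.  There t_i becomes a
    piecewise linear toggle of the level i ([tableau_pattern_bk]), and the
    crystal operator F_i, which turns one i into i + 1, lowers one entry of the
    level i ([lower]).  Toggles of levels far from i commute with F_i, and
    t_i t_(i-1) transports F_i to F_(i-1) ([lower_switch]); hence q_[1,m]
    transports F_i to the inverse of F_(m+1-i) ([lower_evac]).  The patterns that
    agree above the level d form a single component under F_1, ..., F_d, since
    they all flow down to the same lowest pattern ([lowest_uniq]), and q_[1,d]
    stays inside it.  Conjugating by q_[1,m], one finds that q_[j,m] preserves
    the components of F_j, ..., F_m and reverses these operators.  As t_i
    commutes with them, t_i q_[j,m] and q_[j,m] t_i send the lowest pattern of a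
    component to the unique highest pattern of the same component; they agree
    there, and then everywhere by following the operators back. *)

(** * Involutions that generate cactus relations *)

Section Evacuations.
Local Open Scope group_scope.
Variables (G : groupType) (t : nat -> G).
Hypothesis tt : forall i, t i * t i = 1.
Hypothesis tC : forall i j, (i.+1 < j)%N -> commute (t i) (t j).

Definition promotion m : G := \prod_(1 <= b < m.+1) t (m.+1 - b).
Definition evac m : G := \prod_(1 <= a < m.+1) promotion a.
Definition evac_itv j m : G := evac m * evac (m.+1 - j) * evac m.

Lemma promotion0 : promotion 0 = 1. Proof. by rewrite /promotion big_geq. Qed.

Lemma promotionS m : promotion m.+1 = t m.+1 * promotion m.
Proof.
rewrite /promotion big_ltn // subSS subn0; congr (_ * _).
by rewrite big_add1.
Qed.

Lemma evac0 : evac 0 = 1. Proof. by rewrite /evac big_geq. Qed.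

Lemma evacS m : evac m.+1 = evac m * promotion m.+1.
Proof. by rewrite /evac big_nat_recr. Qed.

Lemma evac_itv1 m : evac m * evac m = 1 -> evac_itv 1 m = evac m.
Proof. by rewrite /evac_itv subn1 /= => ->; rewrite mul1g. Qed.

Lemma commute_promotion x m : (forall i, 0 < i <= m -> commute x (t i))%N ->
  commute x (promotion m).
Proof.
elim: m => [|m IH] h; first by rewrite promotion0; exact: commute1.
rewrite promotionS; apply: commuteM; first by apply: h; lia.
by apply: IH => i hi; apply: h; lia.
Qed.

Lemma commute_evac x m : (forall i, 0 < i <= m -> commute x (t i))%N ->
  commute x (evac m).
Proof.
elim: m => [|m IH] h; first by rewrite evac0; exact: commute1.
rewrite evacS; apply: commuteM; last exact: commute_promotion.
by apply: IH => i hi; apply: h; lia.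
Qed.

Lemma commute_t_evac i m : (m.+1 < i)%N -> commute (t i) (evac m).
Proof. by move=> h; apply: commute_evac => j hj; apply/commute_sym/tC; lia. Qed.

(** Writing E_m and P_m for [evac m] and [promotion m], this says that
    E_(m+1) = E_m P_(m+1) is also P_(m+1)^-1 E_m.  That makes E_(m+1) an
    involution when E_m is one. *)
Lemma promotion_evac_promotion m : promotion m.+1 * evac m * promotion m.+1 = evac m.
Proof.
elim: m => [|m IH]; first by rewrite evac0 mulg1 promotionS promotion0 mulg1 tt.
have tq := @commute_t_evac m.+2 m (ltnSn _).
rewrite {2}[promotion m.+2]promotionS {1}[promotion m.+2]promotionS evacS.
have -> : t m.+2 * promotion m.+1 * (evac m * promotion m.+1) * (t m.+2 * promotion m.+1)
   = t m.+2 * (promotion m.+1 * evac m * promotion m.+1) * t m.+2 * promotion m.+1.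
  by rewrite !mulgA.
by rewrite IH tq -[X in X * _]mulgA tt mulg1.
Qed.

Lemma evac_evac m : evac m * evac m = 1.
Proof.
elim: m => [|m IH]; first by rewrite evac0 mulg1.
have -> : evac m.+1 * evac m.+1 = evac m * (promotion m.+1 * evac m * promotion m.+1).
  by rewrite evacS !mulgA.
by rewrite promotion_evac_promotion.
Qed.

Lemma evacV m : (evac m)^-1 = evac m.
Proof. exact: mulg1_eq (evac_evac m). Qed.

Lemma evacSV m : evac m.+1 = (promotion m.+1)^-1 * evac m.
Proof. by rewrite -{1}evacV evacS invgM evacV. Qed.

Lemma evac_itvE j m : evac_itv j m = evac (m.+1 - j) ^ evac m.
Proof. by rewrite /conjg evacV mulgA. Qed.

Lemma conjg_commute (x y : G) : commute x y -> x ^ y = x.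
Proof. by move=> h; rewrite /conjg h mulKg. Qed.

Lemma commute_conjg (x y : G) : x ^ y = x -> commute x y.
Proof. by move=> h; rewrite /commute -{2}h /conjg mulVKg. Qed.

Lemma commuteJ (x y z : G) : commute x y -> commute (x ^ z) (y ^ z).
Proof. by move=> h; rewrite /commute -!conjMg h. Qed.

(** [promotion l.+1] ends with [promotion d.+1]; its other factors have indices
    beyond d + 1 and commute with [evac d]. *)
Lemma evac_conj_promotion d l : (d <= l)%N ->
  evac d ^ promotion l.+1 = evac d ^ promotion d.+1.
Proof.
elim: l => [|l IH]; first by rewrite leqn0 => /eqP ->.
rewrite leq_eqVlt => /predU1P[-> //|dl].
rewrite promotionS conjgM [evac d ^ t _]conjg_commute ?IH //.
by apply/commute_sym/commute_t_evac; lia.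
Qed.

Lemma evac_conjS d l : (d <= l)%N ->
  evac d ^ (evac l * evac l.+1) = evac d ^ evac d.+1.
Proof.
move=> dl; rewrite !evacS mulgA evac_evac mul1g evac_conj_promotion //.
by rewrite conjgM [evac d ^ evac d]conjg_commute.
Qed.

(** Conjugation by [evac l * evac (l + e)] is cut into steps of length one, each
    of which replaces [evac d] by [evac d ^ evac d.+1]. *)
Lemma evac_conj d l e : (d <= l)%N ->
  evac d ^ (evac l * evac (l + e)) = evac d ^ evac (d + e).
Proof.
elim: e d l => [|e IH] d l dl.
  by rewrite !addn0 evac_evac conjg1 conjg_commute.
have -> : evac l * evac (l + e.+1) =
    evac l * evac l.+1 * (evac l.+1 * evac (l.+1 + e)).
  by rewrite -!mulgA (mulgA (evac l.+1)) evac_evac mul1g addSnnS.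
rewrite conjgM evac_conjS // conjJg IH ?IH //; last by lia.
rewrite -conjgM {2}/conjg evacV addSn mulgA conjgM evac_conjS; last by lia.
by rewrite -conjgM mulgA evac_evac mul1g addnS.
Qed.

Lemma evac_itv_conj_evac k l m : (0 < k <= l)%N -> (l <= m)%N ->
  evac_itv k l ^ evac m = evac_itv (m.+1 - l) (m.+1 - k).
Proof.
move=> kl lm; rewrite !evac_itvE -conjgM -(subnKC lm) evac_conj; last by lia.
congr (evac _ ^ evac _); lia.
Qed.

Lemma evac_itv_conj p q k l : (0 < p <= k)%N -> (k <= l <= q)%N ->
  evac_itv k l ^ evac_itv p q = evac_itv (p + q - l) (p + q - k).
Proof.
move=> pk klq.
rewrite [evac_itv p q]evac_itvE {2}/conjg evacV !conjgM.
rewrite !evac_itv_conj_evac; try lia.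
congr evac_itv; lia.
Qed.

Lemma evac_itv_sqr p q : evac_itv p q * evac_itv p q = 1.
Proof. by rewrite evac_itvE -conjMg evac_evac conj1g. Qed.

(** Conjugating by [evac l] moves the interval on the right to one that starts
    at 1; its involution becomes a word in the t_i that lie below the other
    interval. *)
Lemma evac_itv_commute N : 
  (forall i j m, 0 < i -> i.+1 < j -> j <= m -> m < N ->
     commute (t i) (evac_itv j m))%N ->
  (forall p q k l, 0 < p <= q -> q.+1 < k -> k <= l < N ->
     commute (evac_itv p q) (evac_itv k l))%N.
Proof.
move=> tq p q k l pq qk kl.
rewrite -[evac_itv p q](conjgK (evac l)) -[evac_itv k l](conjgK (evac l)).
apply: commuteJ; rewrite !evac_itv_conj_evac; try lia.
rewrite subSnn evac_itv1 ?evac_evac //;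
by apply/commute_evac => i hi; apply/commute_sym/tq; lia.
Qed.
End Evacuations.

(** * Homomorphisms out of quotients and presentations *)

Definition hom_of (G H : groupType) (h : G -> H) (hM : {morph h : x y / (x * y)%g}) :
  {multiplicative G -> H} := HB.pack h (isMultiplicative.Build G H h hM).

Section Homomorphisms.
Local Open Scope group_scope.
Variables G H : groupType.
Implicit Types f : {multiplicative G -> H}.

Lemma hom1 f : f 1 = 1.
Proof. by apply: (mulgI (f 1)); rewrite -gmulfM !mulg1. Qed.

Lemma homV f x : f x^-1 = (f x)^-1.
Proof. by apply/esym/mulg1_eq; rewrite -gmulfM mulgV hom1. Qed.

Definition ker_pred f : pred G := fun x => f x == 1.

Lemma ker_closed f : group_closed (ker_pred f).
Proof.
split=> [|x y]; rewrite !unfold_in /ker_pred ?hom1 // => /eqP fx /eqP fy.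
by rewrite gmulfM homV fx fy mulgV.
Qed.

Lemma ker_conj f (x y : G) : x \in ker_pred f -> x ^ y \in ker_pred f.
Proof.
by rewrite !unfold_in /ker_pred /conjg !gmulfM homV => /eqP ->; rewrite mul1g mulVg.
Qed.

Definition ker f : normal_subgroup G := NormalSubgroup (@ker_closed f) (@ker_conj f).

Lemma in_ker f x : (x \in nsub (ker f)) = (f x == 1).
Proof. by []. Qed.

Lemma quotient_lift (N : normal_subgroup G) f :
  (forall x, x \in nsub N -> f x = 1) ->
  exists g : {multiplicative quotient_group N -> H}, forall x, g (coset N x) = f x.
Proof.
move=> fN; pose g (u : quotient_group N) := f (repr u).
have gE x : g (coset N x) = f x.
  have := fN _ (repr_coset N x); rewrite gmulfM homV => e.
  by rewrite -[LHS](mulVKg (f x)) e mulg1.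
have gM : {morph g : u v / u * v}.
  by elim/coset_ind=> x; elim/coset_ind=> y; rewrite -gmulfM !gE gmulfM.
by exists (hom_of gM).
Qed.

Lemma first_isomorphism f : (forall y, exists x, f x = y) ->
  exists g : {multiplicative quotient_group (ker f) -> H},
    bijective g /\ forall x, g (coset (ker f) x) = f x.
Proof.
move=> fS; have [|g gE] := @quotient_lift (ker f) f.
  by move=> x; rewrite in_ker => /eqP.
exists g; split=> //.
pose s y := coset (ker f) (sval (cid (fS y))).
have sK : cancel s g by move=> y; rewrite /s gE; case: cid.
have g_inj : injective g.
  elim/coset_ind=> x; elim/coset_ind=> y; rewrite !gE => e.
  by apply/cosetP; rewrite in_ker gmulfM homV e mulVg.
by exists s => // u; apply: g_inj; rewrite sK.
Qed.

End Homomorphisms.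

Lemma gvalV (G : groupType) (A : G -> Prop) (x : gen_group A) :
  gval x^-1%g = (gval x)^-1%g.
Proof. by apply/esym/mulg1_eq; rewrite -[LHS](valM x) mulgV val1. Qed.

Section FreeGroupHom.
Local Open Scope group_scope.
Variables (X : choiceType) (G : groupType) (h : X -> G).

Definition letter_val (a : X * bool) : G := if a.2 then (h a.1)^-1 else h a.1.
Definition word_val (w : seq (X * bool)) : G := \prod_(a <- w) letter_val a.

Lemma word_val_eq u v : word_eq u v -> word_val u = word_val v.
Proof.
elim=> {u v} // [u v w _ -> //|u u' v v' _ e _ e'|x b].
  by rewrite /word_val !big_cat /= -/(word_val _) -/(word_val _) e e'.
rewrite /word_val !big_cons !big_nil mulg1 /letter_val /=.
by case: b; rewrite ?mulVg ?mulgV.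
Qed.

Definition free_ext_fun (g : free_group X) : G := word_val (repr g).

Lemma free_ext_word w : free_ext_fun (free_word w) = word_val w.
Proof. by apply/esym/word_val_eq; exact: repr_free_word. Qed.

Lemma free_ext_morph : {morph free_ext_fun : x y / x * y}.
Proof.
elim/free_word_ind=> u; elim/free_word_ind=> v.
have -> : free_word u * free_word v = free_word (u ++ v) by exact: free_mulE.
by rewrite !free_ext_word /word_val big_cat.
Qed.

Definition free_ext : {multiplicative free_group X -> G} := hom_of free_ext_morph.

Lemma free_ext_gen x : free_ext (free_gen x) = h x.
Proof. by rewrite [LHS]free_ext_word /word_val big_seq1. Qed.

Variable R : free_group X -> free_group X -> Prop.

Lemma presented_ext : (forall u v, R u v -> free_ext u = free_ext v) ->
  exists f : {multiplicative presented_group R -> G}, forall x, f (pgen R x) = h x.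
Proof.
move=> hR.
have [|f fE] := @quotient_lift _ _
    (normal_closure (fun w => exists u v, R u v /\ w = u * v^-1)) free_ext.
  move=> x /asboolP hx; apply/eqP; rewrite -in_ker; apply: hx => _ [u [v [uv ->]]].
  by rewrite in_ker gmulfM homV (hR _ _ uv) mulgV.
by exists f => x; rewrite -free_ext_gen -fE.
Qed.

End FreeGroupHom.

Section PresentedInduction.
Local Open Scope group_scope.
Variables (X : choiceType) (R : free_group X -> free_group X -> Prop).

Lemma presented_ind (P : presented_group R -> Prop) :
  P 1 -> (forall x g, P g -> P (pgen R x * g)) ->
  (forall x g, P g -> P ((pgen R x)^-1 * g)) -> forall g, P g.
Proof.
move=> P1 Pgen PgenV; elim/coset_ind; elim/free_word_ind; elim=> // -[x b] w IH.
have -> : free_word ((x, b) :: w) = free_word [:: (x, b)] * free_word w.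
  by apply/esym; exact: (free_mulE [:: (x, b)]).
rewrite coset_is_mul; case: b; last exact: Pgen.
suff -> : coset (normal_closure (fun w => exists u v, R u v /\ w = u * v^-1))
   (free_word [:: (x, true)]) = (pgen R x)^-1 by exact: PgenV.
have -> : free_word [:: (x, true)] = (free_gen x)^-1.
  by apply/esym; exact: (free_invE [:: (x, false)]).
by apply/esym; exact: quot_invE.
Qed.

Lemma presented_uniq (G : groupType) (f f' : {multiplicative presented_group R -> G}) :
  (forall x, f (pgen R x) = f' (pgen R x)) -> f =1 f'.
Proof.
move=> e; apply: presented_ind => [|x g IH|x g IH]; first by rewrite !hom1.
  by rewrite !gmulfM e IH.
by rewrite !gmulfM !homV e IH.
Qed.

Lemma pgen_rel u v : R u v ->
  coset (normal_closure (fun w => exists u v, R u v /\ w = u * v^-1)) u =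
  coset (normal_closure (fun w => exists u v, R u v /\ w = u * v^-1)) v.
Proof.
move=> uv; apply/cosetP/asboolP => N hN.
have h1 : v * u^-1 \in nsub N.
  have := group_closedV (nsub_closed N) (hN (u * v^-1) _).
  by rewrite invgM invgK; apply; exists u, v.
by have := nsub_conj u h1; rewrite /conjg mulgVK.
Qed.

Lemma pgen_mulE x y : pgen R x * pgen R y =
  coset (normal_closure (fun w => exists u v, R u v /\ w = u * v^-1))
    (free_gen x * free_gen y).
Proof. exact: quot_mulE. Qed.

End PresentedInduction.

(** * Gelfand-Tsetlin patterns and toggles *)

Section Patterns.
Local Open Scope ring_scope.

(** Integer entries, with interlacing as a separate predicate, make a toggle an
    involution of the whole type, hence a permutation of it. *)
Definition pattern := nat -> nat -> int.
Implicit Types (g h x y : pattern) (a b c d : nat -> int).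

(** The interlacing conditions of Gelfand and Tsetlin: consecutive levels differ
    by a horizontal strip. *)
Definition is_pattern g : Prop :=
  (forall r, g 0%N r = 0) /\ forall i r, g i.+1 r.+1 <= g i r <= g i.+1 r.

Lemma pattern_eq g h : (forall i r, g i r = h i r) -> g = h.
Proof. by move=> e; apply/funext => i; apply/funext => r. Qed.

Lemma pattern_ge0 g i r : is_pattern g -> 0 <= g i r.
Proof.
case=> g0 gi; elim: i r => [|i IH] r; first by rewrite g0.
by have := gi i r; have := IH r; lia.
Qed.

Lemma pattern_out g i r : is_pattern g -> (i <= r)%N -> g i r = 0.
Proof.
move=> gP; case: (gP) => g0 gi; elim: i r => [|i IH] [|r] // ir.
by have := gi i r; have := IH r ir; have := pattern_ge0 i.+1 r.+1 gP; lia.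
Qed.

(** The entry b r is reflected in the interval of its possible values, given the
    levels a below and c above.  In the row 0 its only upper bound is c 0. *)
Definition toggle_row a b c (r : nat) : int :=
  (if r is r'.+1 then Num.min (c r) (a r') else c r)
  + Num.max (c r.+1) (a r) - b r.

Definition toggle i g : pattern := fun l =>
  if (0 < i)%N && (l == i) then toggle_row (g i.-1) (g i) (g i.+1) else g l.

Lemma toggle_neq i g l : l != i -> toggle i g l = g l.
Proof. by rewrite /toggle => /negbTE ->; rewrite andbF. Qed.

Lemma toggle_eq i g : toggle i.+1 g i.+1 = toggle_row (g i) (g i.+1) (g i.+2).
Proof. by rewrite /toggle eqxx. Qed.

Lemma toggle_rowK a b c : toggle_row a (toggle_row a b c) c = b.
Proof. by apply/funext => -[|r]; rewrite /toggle_row; lia. Qed.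

Lemma toggleK i : involutive (toggle i).
Proof.
case: i => [|i] g; first by apply/funext=> l.
apply/funext => l; have [->|h] := eqVneq l i.+1; last by rewrite !toggle_neq.
by rewrite toggle_eq (@toggle_neq _ _ i) ?(@toggle_neq _ _ i.+2) ?toggle_eq
  ?toggle_rowK //; lia.
Qed.

Lemma toggle_comm i j g : (i.+1 < j)%N ->
  toggle i (toggle j g) = toggle j (toggle i g).
Proof.
case: i => [|i]; case: j => [|j] // ij; apply/funext => l.
have [-> | li] := eqVneq l i.+1.
  by rewrite toggle_eq [RHS]toggle_neq ?toggle_eq ?(@toggle_neq j.+1) //; lia.
have [-> | lj] := eqVneq l j.+1.
  by rewrite toggle_neq ?toggle_eq ?(@toggle_neq i.+1) //; lia.
by rewrite !toggle_neq.
Qed.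

Lemma toggle_pattern i g : is_pattern g -> is_pattern (toggle i g).
Proof.
case: i => [|i] // [g0 gi]; split=> [r|l r]; first by rewrite toggle_neq.
have gi1 := gi i; have gi2 := gi i.+1.
have [-> | li] := eqVneq l i.
  rewrite (@toggle_neq i.+1 _ i) ?toggle_eq /toggle_row; last by lia.
  have := gi1 r.+1; have := gi2 r.+1; have := gi1 r; have := gi2 r.
  by case: r => [|r]; [|have := gi1 r; have := gi2 r]; lia.
have [-> | li'] := eqVneq l i.+1.
  rewrite (@toggle_neq i.+1 _ i.+2) ?toggle_eq /toggle_row; last by lia.
  have := gi1 r.+1; have := gi2 r.+1; have := gi1 r; have := gi2 r.
  by case: r => [|r]; [|have := gi1 r; have := gi2 r]; lia.
by rewrite !toggle_neq.
Qed.

Definition toggle_perm i : permutation pattern := perm_of (inv_bij (toggleK i)).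

Lemma toggle_perm_sqr i : (toggle_perm i * toggle_perm i = 1)%g.
Proof. by apply: permutation_eq => g; exact: toggleK. Qed.

Lemma toggle_perm_comm i j : (i.+1 < j)%N ->
  commute (toggle_perm i) (toggle_perm j).
Proof. by move=> ij; apply: permutation_eq => g; exact: toggle_comm. Qed.

End Patterns.

(** * Crystal operators on patterns *)

Section Crystal.
Local Open Scope ring_scope.
Implicit Types (g h x y : pattern) (a b c d : nat -> int).

(** The signature rule.  With b r - a r letters i and c r - b r letters i + 1 in
    the row r, the letters i + 1 of the row r + 1 are bracketed with the letters
    i of the row r or of higher rows.  Reading from the bottom row up, the
    height increases by the letters i gained and decreases by the letters i + 1
    met in between, so the last unbracketed i sits in the row where the height
    first reaches its maximum. *)
Fixpoint height a b c (r : nat) : int :=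
  if r is r'.+1 then
    height a b c r' - (b r' - a r' - (c r - b r))
  else 0.

(** First for the bottom-up reading, that is, the largest index.  A height that
    is maximal on its constant tail has no first maximum; this is the case where
    every letter i is bracketed. *)
Definition first_max (f : nat -> int) r : Prop :=
  (forall s, (r < s)%N -> f s < f r) /\ (forall s, (s < r)%N -> f s <= f r).

Lemma first_max_inj f r s : first_max f r -> first_max f s -> r = s.
Proof.
move=> [r1 r2] [s1 s2]; case: (ltngtP r s) => // h.
  by have := r1 _ h; have := s2 _ h; lia.
by have := r2 _ h; have := s1 _ h; lia.
Qed.

Lemma first_max_ex f K : (forall r, (K <= r)%N -> f r = f K) ->
  (exists r, first_max f r) \/ (forall s, f s <= f K).
Proof.
move=> fK.
(* The restriction of f to the indices from K - m on; m increases to K. *)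
have main m : (exists r, [/\ (K - m <= r)%N, forall s, (r < s)%N -> f s < f r &
     forall s, (K - m <= s < r)%N -> f s <= f r]) \/
   (forall s, (K - m <= s)%N -> f s <= f K).
  elim: m => [|m [[r [h1 h2 h3]]|h]].
  - by right=> s hs; rewrite fK //; lia.
  - have [le|lt] := lerP (f (K - m.+1)%N) (f r).
      left; exists r; split=> [|//|s hs]; first by lia.
      have [->//|ne] := eqVneq s (K - m.+1)%N; apply: h3; lia.
    have [e|ne] := eqVneq (K - m.+1)%N (K - m)%N.
      by left; exists r; split=> //; rewrite e.
    left; exists (K - m.+1)%N; split=> // s hs; last by lia.
    have [sr|sr|->] := ltngtP s r; last by lia.
      by have := h3 s; lia.
    by have := h2 s sr; lia.
  - have [le|lt] := lerP (f (K - m.+1)%N) (f K).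
      right=> s hs; have [->//|ne] := eqVneq s (K - m.+1)%N; apply: h; lia.
    have [e|ne] := eqVneq (K - m.+1)%N (K - m)%N; first by right; rewrite e.
    left; exists (K - m.+1)%N; split=> // s hs; last by lia.
    by have := h s; lia.
case: (main K) => [[r [_ h1 h2]]|h].
  by left; exists r; split=> // s hs; apply: h2; lia.
by right=> s; apply: h; lia.
Qed.

Definition decr (f : nat -> int) r : nat -> int :=
  fun s => if s == r then f s - 1 else f s.

Lemma decrE (f : nat -> int) r s : decr f r s = (f s - (s == r)%:Z)%R.
Proof. by rewrite /decr; case: eqP; lia. Qed.

Definition decr_level i r g : pattern :=
  fun l => if l == i then decr (g l) r else g l.

Lemma decr_level_eq i r g : decr_level i r g i = decr (g i) r.
Proof. by rewrite /decr_level eqxx. Qed.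

Lemma decr_level_neq i r g l : l != i -> decr_level i r g l = g l.
Proof. by rewrite /decr_level => /negbTE ->. Qed.

Definition level_height i g := height (g i.-1) (g i) (g i.+1).

(** The graph of the crystal operator F_i, which turns an i into i + 1. *)
Definition lower i g h : Prop :=
  exists2 r, first_max (level_height i g) r & h = decr_level i r g.

Lemma lower_fun i g h h' : lower i g h -> lower i g h' -> h = h'.
Proof. by move=> [r hr ->] [s hs ->]; rewrite (first_max_inj hr hs). Qed.

Lemma height_out i g r : is_pattern g -> (0 < i)%N -> (i <= r)%N ->
  level_height i g r = level_height i g i.
Proof.
move=> gP i0; elim: r => [|r IH]; first by lia.
rewrite leq_eqVlt => /predU1P[-> //|ir].
rewrite -IH // /level_height /=; rewrite !(pattern_out gP); lia.
Qed.

Lemma lower_entry i g r : first_max (level_height i g) r ->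
  0 < g i r - g i.-1 r - (g i.+1 r.+1 - g i r.+1).
Proof. by case=> h _; have := h _ (ltnSn r); rewrite /level_height /=; lia. Qed.

Lemma lower_row i g r : is_pattern g -> (0 < i)%N ->
  first_max (level_height i g) r -> (r < i)%N.
Proof.
move=> gP i0 [h _]; rewrite ltnNge; apply/negP=> ir.
have := h _ (ltnSn r).
by rewrite (height_out gP i0 ir) (height_out gP i0 (leqW ir)) ltxx.
Qed.

(** At the first maximum the letters i of the row r outnumber the letters i + 1
    of the row r + 1; so g i r exceeds both entries that bound it from below,
    g (i - 1) r and g (i + 1) (r + 1). *)
Lemma lower_pattern i g h : (0 < i)%N -> is_pattern g -> lower i g h ->
  is_pattern h.
Proof.
case: i => // i _ gP [r hr ->]; have := lower_entry hr; rewrite /= => d.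
case: (gP) => g0 gi; split=> [s|l s].
  by rewrite /decr_level /=.
have a1 := gi i r; have a2 := gi i.+1 r; have a3 := gi i.+1 r.+1.
have := gi l s; rewrite /decr_level /decr.
have [-> | li] := eqVneq l i.+1.
  by rewrite [i.+2 == _]gtn_eqF //; have [->|] := eqVneq s r; lia.
have [li' | li'] := eqVneq l.+1 i.+1; last by lia.
have -> : l = i by lia.
by case: (eqVneq s.+1 r) => [er|_]; case: (eqVneq s r) => [->|_]; lia.
Qed.

End Crystal.

(** * Toggles intertwine crystal operators *)

Section ZigZag.
Local Open Scope ring_scope.
Variables (P Q W u w : nat -> int) (k : int).
Hypothesis WS : forall s, W s.+1 = W s - u s + w s.
Hypothesis P0 : P 0%N = W 0%N.
Hypothesis PS : forall s, P s.+1 = W s.+1 + Num.max (u s) 0.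
Hypothesis QE : forall s, Q s + k = W s + Num.max (w s) 0.

(** The path W 0, W 0 + w 0 = W 1 + u 0, W 1, W 1 + w 1 = W 2 + u 1, ... visits
    pairs of consecutive values whose maxima are, up to a constant, the P s and
    the Q s: P s is the larger of W s and W s + u (s - 1), and Q s the larger of
    W s and W s + w s.  Followed from large s down to 0, the path therefore
    attains its first maximum in the rows where P and Q do, and these differ, by
    one, exactly when it is at an intermediate point. *)
Definition switch_row r := if r is s.+1 then (if 0 < u s then s else r) else 0%N.

Lemma zigzag_le s : W s <= P s.
Proof. by case: s => [|s]; rewrite ?P0 ?PS; lia. Qed.

Lemma zigzag_le' s : W s + w s <= P s.+1.
Proof. by rewrite PS WS; lia. Qed.

Lemma first_max_switch r : first_max P r -> first_max Q (switch_row r).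
Proof.
move=> [h1 h2].
have above s : (s.+1 < r)%N -> W s <= P r /\ W s + w s <= P r.
  move=> hs; have := zigzag_le s; have := zigzag_le' s.
  by have := h2 _ hs; have := h2 s (ltnW hs); lia.
have below s : (r < s)%N -> W s < P r /\ W s + w s < P r.
  move=> hs; have := zigzag_le s; have := zigzag_le' s.
  by have := h1 _ hs; have := h1 s.+1 (leqW hs); lia.
have at_r : W r + w r < P r.
  by have := zigzag_le' r; have := h1 _ (ltnSn r); lia.
case: r h1 h2 above below at_r => [|r] h1 h2 above below at_r.
  rewrite /=; split=> s hs; last by lia.
  by have := below s hs; have := QE s; have := QE 0%N; lia.
have le_r := zigzag_le r; have le_r' := zigzag_le' r; have P_r := h2 r (ltnSn r).
have Pr := PS r; have Wr := WS r; rewrite /=; case: ifP => ur; split=> s hs.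
- have := QE s; have := QE r; have [->|ne] := eqVneq s r.+1; first by lia.
  by have := below s; lia.
- by have := QE s; have := QE r; have := above s hs; lia.
- by have := QE s; have := QE r.+1; have := below s hs; lia.
- have := QE s; have := QE r.+1; have [->|ne] := eqVneq s r; first by lia.
  by have := above s; lia.
Qed.

Lemma first_max_switchV s : first_max Q s -> exists r, first_max P r.
Proof.
move=> [h1 h2]; have Qs := QE s.
have le x : P x <= Num.max (Q x + k) (if x is y.+1 then Q y + k else Q x + k).
  case: x => [|x]; first by have := QE 0%N; have := P0; lia.
  by have := QE x; have := QE x.+1; have := PS x; have := WS x; lia.
have [ws|ws] := ltrP (w s) 0.
  have Ps : W s <= P s := zigzag_le s.
  exists s; split=> x hx.
    have := le x; case: x hx => // x hx; have := h1 _ hx.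
    have [e|ne] := eqVneq x s; last by have := h1 x; lia.
    rewrite e in hx *; have := PS s; have := WS s; have := QE s.+1; lia.
  by have := le x; have := h2 _ hx; case: x hx => [|x] hx; [|have := h2 x]; lia.
exists s.+1; have Ps := PS s; have Ws := WS s; split=> x hx.
  have := le x; case: x hx => // x hx; have := h1 x.+1; have := h1 x; lia.
have := le x; have xs : Q x <= Q s.
  by have [->//|ne] := eqVneq x s; apply: h2; lia.
by case: x hx xs => [|x] hx xs; [|have := h2 x]; lia.
Qed.

(** The signs of the steps of the path next to its first maximum; they decide
    which arguments realise the minima and maxima of the toggles. *)
Lemma first_max_signs r : first_max P r ->
  match r return Prop with
  | 0%N => w 0%N < 0
  | s.+1 => (0 < u s -> 0 <= w s) /\ (u s <= 0 -> w r < 0)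
  end.
Proof.
move=> [h1 h2]; have := zigzag_le' r; have := h1 _ (ltnSn r).
case: r h1 h2 => [|r] h1 h2; first by lia.
have := PS r; have := WS r; have := h2 r (ltnSn r); have := zigzag_le r; lia.
Qed.
End ZigZag.

Section Switch.
Local Open Scope ring_scope.
Variables a b c d : nat -> int.

(** For the two toggles that carry the levels a, b, c, d to a, b', c', d, the
    steps u and w of the path are the overhangs of c over a and of d over b'. *)
Definition overhang a c (r : nat) : int := c r.+1 - a r.

Local Notation b' := (toggle_row a b c).
Local Notation c' := (toggle_row b' c d).

Fixpoint zigzag (r : nat) : int :=
  if r is s.+1 then zigzag s - overhang a c s + overhang b' d s else 0.

Lemma height_zigzag s :
  height b c d s.+1 = zigzag s.+1 + Num.max (overhang a c s) 0.
Proof.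
elim: s => [|s IH]; first by rewrite /= /overhang /toggle_row; lia.
have -> : height b c d s.+2 =
  height b c d s.+1 - (c s.+1 - b s.+1 - (d s.+2 - c s.+2)) by [].
by rewrite IH /= /overhang /toggle_row; lia.
Qed.

Lemma height_switch_zigzag s :
  height a b' c' s + Num.max (overhang b' d 0) 0 =
  zigzag s + Num.max (overhang b' d s) 0.
Proof.
elim: s => [|s IH]; first by [].
have -> : height a b' c' s.+1 =
  height a b' c' s - (b' s - a s - (c' s.+1 - b' s.+1)) by [].
have -> : zigzag s.+1 = zigzag s - overhang a c s + overhang b' d s by [].
have e : c' s.+1 + c s.+1 = Num.min (d s.+1) (b' s) + Num.max (d s.+2) (b' s.+1).
  by rewrite {1}/toggle_row; lia.
move: IH e; rewrite /overhang; lia.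
Qed.

Lemma first_max_toggles r : first_max (height b c d) r ->
  first_max (height a b' c') (switch_row (overhang a c) r).
Proof. by apply: (first_max_switch _ _ height_zigzag height_switch_zigzag). Qed.

Lemma first_max_togglesV s : first_max (height a b' c') s ->
  exists r, first_max (height b c d) r.
Proof. by apply: (first_max_switchV _ _ height_zigzag height_switch_zigzag). Qed.

(** Lowering c lowers b' once, in the row that the crystal operator prescribes,
    and leaves c' alone: the change of c and that of b' cancel in the toggle. *)
Lemma toggle_decr r : first_max (height b c d) r ->
  toggle_row a b (decr c r) = decr b' (switch_row (overhang a c) r) /\
  toggle_row (decr b' (switch_row (overhang a c) r)) (decr c r) d = c'.
Proof.
move=> /(@first_max_signs (height b c d) zigzag _ (overhang b' d)
  (fun s => erefl) erefl height_zigzag).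
rewrite /overhang.
case: r => [|r] /=; last case: ifP => ur.
- move=> w0; split; apply/funext => x.
    by case: x => [|x]; rewrite /toggle_row !decrE; lia.
  move: (toggle_row a b c) w0 => b1 w0.
  by case: x => [|[|x]]; rewrite /toggle_row !decrE; lia.
- move=> [/(_ isT) wr _].
  have rows x : x = r \/ x = r.+1 \/ (x != r) && (x != r.+1) by lia.
  split; apply/funext => x.
    case: (rows x) => [->|[->|ne]].
    + by case: r ur wr {rows} => [|r] ur wr; rewrite /toggle_row !decrE; lia.
    + by rewrite /toggle_row !decrE; lia.
    + by case: x ne => [|x] ne; rewrite /toggle_row !decrE; lia.
  move: (toggle_row a b c) wr => b1 wr; case: (rows x) => [->|[->|ne]].
  + by case: r ur wr {rows} => [|r] ur wr; rewrite /toggle_row !decrE; lia.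
  + by rewrite /toggle_row !decrE; lia.
  + by case: x ne => [|x] ne; rewrite /toggle_row !decrE; lia.
- move/negbT: ur; rewrite -leNgt => ur [_ /(_ ur)] wr.
  have rows x :
    x = r \/ x = r.+1 \/ x = r.+2 \/ [&& x != r, x != r.+1 & x != r.+2] by lia.
  split; apply/funext => x.
    case: (rows x) => [->|[->|[->|ne]]].
    + by case: r ur wr {rows} => [|r] ur wr; rewrite /toggle_row !decrE; lia.
    + by rewrite /toggle_row !decrE; lia.
    + by rewrite /toggle_row !decrE; lia.
    + by case: x ne => [|x] ne; rewrite /toggle_row !decrE; lia.
  move: (toggle_row a b c) wr => b1 wr; case: (rows x) => [->|[->|[->|ne]]].
  + by case: r ur wr {rows} => [|r] ur wr; rewrite /toggle_row !decrE; lia.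
  + by rewrite /toggle_row !decrE; lia.
  + by rewrite /toggle_row !decrE; lia.
  + by case: x ne => [|x] ne; rewrite /toggle_row !decrE; lia.
Qed.
End Switch.

Section LowerToggle.
Local Open Scope ring_scope.
Implicit Types (g h x y : pattern).

Lemma lower_toggle_far i j g h : (i.+1 < j)%N || (j.+1 < i)%N ->
  lower i g h -> lower i (toggle j g) (toggle j h).
Proof.
move=> ij [r hr ->]; exists r.
  by rewrite /level_height !toggle_neq //; lia.
apply/funext => l; have [-> | lj] := eqVneq l j.
  rewrite [RHS]decr_level_neq; last by lia.
  case: j ij => [|j] ij; first by rewrite /toggle /= decr_level_neq //; lia.
  by rewrite !toggle_eq !decr_level_neq //; lia.
rewrite toggle_neq //; have [-> | li] := eqVneq l i.
  by rewrite !decr_level_eq toggle_neq //; lia.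
by rewrite !decr_level_neq // toggle_neq.
Qed.

(** The level 1 has a single entry, which the toggle reflects in the interval
    given by the level 2, while the operator moves it down by one. *)
Lemma lower_toggle1 g h : is_pattern g -> lower 1 g h ->
  lower 1 (toggle 1 h) (toggle 1 g).
Proof.
move=> gP [r hr ->]; have r0 : r = 0%N.
  by have := @lower_row 1 _ _ gP isT hr; lia.
rewrite {}r0 in hr *.
have z0 s : g 0%N s = 0 by exact: pattern_out.
have z1 s : g 1%N s.+1 = 0 by exact: pattern_out.
have z2 s : g 2%N s.+2 = 0 by exact: pattern_out.
have := lower_entry hr; rewrite /= !(z0, z1) => pos.
case: (gP) => g0 gi; have g2 := gi 1%N 0%N.
exists 0%N.
  rewrite /level_height toggle_eq !(@toggle_neq 1) // decr_level_eq !decr_level_neq //.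
  have z s : (0 < s)%N -> height (g 0%N)
     (toggle_row (g 0%N) (decr (g 1%N) 0) (g 2%N)) (g 2%N) s < 0.
    elim: s => // s IH _; rewrite [height _ _ _ _]/= {2 3}/toggle_row !decrE.
    case: s IH => [|s] IH; first by rewrite /= !(z0, z1, z2); lia.
    by have := IH isT; have := pattern_ge0 2 s.+1 gP; rewrite !(z0, z1, z2); lia.
  by split=> // s; exact: z.
apply/funext => l; have [->|l1] := eqVneq l 1%N; last first.
  by rewrite decr_level_neq // !toggle_neq // decr_level_neq.
rewrite decr_level_eq !toggle_eq decr_level_eq !decr_level_neq //; apply/funext => s.
by case: s => [|s]; rewrite decrE /toggle_row decrE; lia.
Qed.

Lemma switch_level1 i g : toggle i.+2 (toggle i.+1 g) i.+1 =
  toggle_row (g i) (g i.+1) (g i.+2).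
Proof. by rewrite toggle_neq ?toggle_eq //; lia. Qed.

Lemma switch_level2 i g : toggle i.+2 (toggle i.+1 g) i.+2 =
  toggle_row (toggle_row (g i) (g i.+1) (g i.+2)) (g i.+2) (g i.+3).
Proof.
by rewrite toggle_eq toggle_eq !(@toggle_neq i.+1) //; lia.
Qed.

Lemma switch_level_neq i g l : l != i.+1 -> l != i.+2 ->
  toggle i.+2 (toggle i.+1 g) l = g l.
Proof. by move=> h1 h2; rewrite !toggle_neq. Qed.

Lemma level_height_switch i g :
  level_height i.+1 (toggle i.+2 (toggle i.+1 g)) =
  height (g i) (toggle_row (g i) (g i.+1) (g i.+2))
    (toggle_row (toggle_row (g i) (g i.+1) (g i.+2)) (g i.+2) (g i.+3)).
Proof.
by rewrite /level_height switch_level1 switch_level2 switch_level_neq //; lia.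
Qed.

Lemma first_max_lower_switch i g r :
  first_max (level_height i.+2 g) r ->
  first_max (level_height i.+1 (toggle i.+2 (toggle i.+1 g)))
     (switch_row (overhang (g i) (g i.+2)) r).
Proof. by rewrite level_height_switch; exact: first_max_toggles. Qed.

(** The two toggles slide the letters i + 1 past the letters i + 2 and i + 3,
    which are renamed i + 1 and i + 2; a slide commutes with crystal operators,
    and the renaming shifts their index. *)
Lemma lower_switch i g h : lower i.+2 g h ->
  lower i.+1 (toggle i.+2 (toggle i.+1 g)) (toggle i.+2 (toggle i.+1 h)).
Proof.
move=> [r hr ->]; eexists; first exact: first_max_lower_switch hr.
have [e1 e2] := toggle_decr (g i) hr.
apply/funext => l.
have [->|l2] := eqVneq l i.+2.
  rewrite decr_level_neq ?switch_level2; last by lia.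
  by rewrite decr_level_eq !decr_level_neq ?e1 ?e2 //; lia.
have [->|l1] := eqVneq l i.+1.
  rewrite decr_level_eq !switch_level1 decr_level_eq.
  by rewrite !decr_level_neq ?e1 //; lia.
by rewrite switch_level_neq // !decr_level_neq // switch_level_neq.
Qed.

(** The operator is defined before the two toggles if it is defined after them;
    the rest is [lower_switch], as operators are single-valued. *)
Lemma lower_switchV i g h :
  lower i.+1 (toggle i.+2 (toggle i.+1 g)) (toggle i.+2 (toggle i.+1 h)) ->
  lower i.+2 g h.
Proof.
move=> gh; case: (gh) => s hs _.
have [r hr] : exists r, first_max (level_height i.+2 g) r.
  by rewrite level_height_switch in hs; exact: first_max_togglesV hs.
have gh' : lower i.+2 g (decr_level i.+2 r g) by exists r.
have := lower_fun gh (lower_switch gh').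
by move/(can_inj (toggleK _))/(can_inj (toggleK _)) => ->.
Qed.

End LowerToggle.

(** * Evacuation and its locality *)

Section Schutzenberger.
Local Open Scope nat_scope.
Implicit Types (g h x y z : pattern).

Local Notation tog := toggle_perm.
Local Notation prm := (promotion tog).
Local Notation evc := (evac tog).
Local Notation evi := (evac_itv tog).

Lemma prmS m g : prm m.+1 g = toggle m.+1 (prm m g).
Proof. by rewrite promotionS. Qed.

Lemma prm0 g : prm 0 g = g. Proof. by rewrite promotion0. Qed.

Lemma evcS m g : evc m.+1 g = evc m (prm m.+1 g).
Proof. by rewrite evacS. Qed.

Lemma evc0 g : evc 0 g = g. Proof. by rewrite evac0. Qed.

Lemma evcK m : involutive (evc m).
Proof.
move=> g; have := evac_evac toggle_perm_sqr toggle_perm_comm m.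
by move/(congr1 (fun f : permutation pattern => f g)).
Qed.

Lemma promotion_evc m g : prm m.+1 (evc m.+1 g) = evc m g.
Proof.
have := evacSV toggle_perm_sqr toggle_perm_comm m.
move/(congr1 (fun f : permutation pattern => (prm m.+1 * f)%g g)).
by rewrite mulVKg.
Qed.

Lemma prm_pattern m g : is_pattern g -> is_pattern (prm m g).
Proof. by move=> gP; elim: m => [|m IH]; rewrite ?prm0 // prmS; apply: toggle_pattern. Qed.

Lemma evc_pattern m g : is_pattern g -> is_pattern (evc m g).
Proof.
elim: m g => [|m IH] g gP; first by rewrite evc0.
by rewrite evcS; apply/IH/prm_pattern.
Qed.

Lemma evac_itv_pattern j m g : is_pattern g -> is_pattern (evi j m g).
Proof. by move=> gP; do 3!apply: evc_pattern. Qed.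

Lemma prm_level m g l : m < l -> prm m g l = g l.
Proof.
elim: m => [|m IH] ml; first by rewrite prm0.
by rewrite prmS toggle_neq ?IH //; lia.
Qed.

Lemma evc_level m g l : m < l -> evc m g l = g l.
Proof.
elim: m g => [|m IH] g ml; first by rewrite evc0.
by rewrite evcS IH ?prm_level //; lia.
Qed.

Lemma lower_toggle_farE i j g h : (i.+1 < j) || (j.+1 < i) ->
  lower i g h <-> lower i (toggle j g) (toggle j h).
Proof.
move=> ij; split; first exact: lower_toggle_far.
by move/(lower_toggle_far ij); rewrite !toggleK.
Qed.

Lemma lower_promotion_far i m g h : m.+1 < i ->
  lower i g h <-> lower i (prm m g) (prm m h).
Proof.
elim: m => [|m IH] mi; first by rewrite !prm0.
rewrite !prmS -lower_toggle_farE; last by lia.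
by apply: IH; lia.
Qed.

(** Of the toggles 1, ..., m + 1, only those of indices i + 1 and i + 2 meet the
    operator; the earlier ones are far from i + 2 and the later ones from
    i + 1. *)
Lemma lower_promotion i m g h : i.+1 < m.+1 ->
  lower i.+2 g h <-> lower i.+1 (prm m.+1 g) (prm m.+1 h).
Proof.
move=> im; rewrite -(subnKC im); elim: (m.+1 - _) => [|k IH].
  rewrite addn0 !prmS; split; last by move/lower_switchV; rewrite -lower_promotion_far.
  by rewrite (@lower_promotion_far _ i) //; exact: lower_switch.
by rewrite addnS !(prmS (i.+2 + k)) -lower_toggle_farE; [exact: IH | lia].
Qed.

(** The Schutzenberger involution exchanges the operators of indices i and
    m + 1 - i, reversing their direction.  For i > 1 promotion brings the index
    down; for i = 1 the expression of [evac m.+1] that starts with the inverse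
    of a promotion brings it up from m. *)
Lemma lower_evac i m g h : 0 < i <= m -> is_pattern g ->
  lower i g h -> lower (m.+1 - i) (evc m h) (evc m g).
Proof.
elim: m i g h => [|m IH] i g h im gP gh; first by lia.
(* In turn i = 1 with m = 0, i = 1 with m > 0, and i > 1. *)
case: i => [|[|i]] in im gh *; first by [].
  case: m => [|m] in IH im *.
    by rewrite !evcS !evc0 !prmS !prm0; exact: lower_toggle1.
  have := IH 1 _ _ isT gP gh; rewrite !subSS !subn0.
  by rewrite -(promotion_evc m.+1 g) -(promotion_evc m.+1 h) -lower_promotion.
rewrite !evcS; have -> : m.+2 - i.+2 = m.+1 - i.+1 by lia.
apply: IH; [by lia | exact: prm_pattern | by rewrite -lower_promotion].
Qed.

Lemma lower_evac_itv i j m g h : 0 < j -> j <= i <= m -> is_pattern g ->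
  lower i g h -> lower (j + m - i) (evi j m h) (evi j m g).
Proof.
move=> j0 ijm gP gh; have iP : 0 < i by lia.
have hP := lower_pattern iP gP gh.
have h1 : lower (m.+1 - i) (evc m h) (evc m g) by apply: lower_evac => //; lia.
have h2 : lower (m.+1 - j.-1 - (m.+1 - i))
  (evc (m.+1 - j) (evc m g)) (evc (m.+1 - j) (evc m h)).
  have -> : m.+1 - j.-1 = (m.+1 - j).+1 by lia.
  by apply: lower_evac h1; [lia | exact: evc_pattern].
have h3 : lower (m.+1 - (m.+1 - j.-1 - (m.+1 - i)))
  (evc m (evc (m.+1 - j) (evc m h))) (evc m (evc (m.+1 - j) (evc m g))).
  by apply: lower_evac h2; [lia | do 2!apply: evc_pattern].
by move: h3; congr lower; lia.
Qed.

Definition lower_step j m g h : Prop :=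
  is_pattern g /\ exists2 i, 0 < i /\ j <= i <= m & lower i g h.

(** Being in the same connected component of the crystal restricted to the
    indices from j to m. *)
Definition linked j m := clos_refl_sym_trans _ (lower_step j m).

Definition lowest j m g : Prop := forall h, ~ lower_step j m g h.
Definition highest j m h : Prop := forall g, ~ lower_step j m g h.

(** Bounds the number of operators that can be applied in succession: the
    operator of index i <= m only touches a row r < i. *)
Definition mass m g : nat := \sum_(i < m.+1) \sum_(r < m.+1) `|g i r|%N.

Lemma step_pattern j m g h : lower_step j m g h -> is_pattern h.
Proof. by move=> [gP [i [i0 _] /(lower_pattern i0 gP)]]. Qed.

Lemma step_mass j m g h : lower_step j m g h -> mass m h < mass m g.
Proof.
move=> [gP [i [i0 im] [r hr ->]]].
have ri := lower_row gP i0 hr; have := lower_entry hr.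
have im' : i < m.+1 by lia. have rm : r < m.+1 by lia.
have d2 : (g i.+1 r.+1 <= g i r)%R.
  by case: gP => _ /(_ i r); lia.
have p1 := pattern_ge0 i.-1 r gP; have p2 := pattern_ge0 i.+1 r.+1 gP.
have p3 := pattern_ge0 i r gP.
have d4 : (g i r.+1 <= g i.-1 r)%R by case: (i) i0 gP => //= k _ [_ /(_ k r)]; lia.
have d5 : (g i r.+1 <= g i.+1 r.+1)%R by case: gP => _ /(_ i r.+1); lia.
move=> d.
rewrite /mass (bigD1 (Ordinal im')) //= [X in _ < X](bigD1 (Ordinal im')) //=.
rewrite decr_level_eq -addSn leq_add //; last first.
  by apply: leq_sum => k ki; rewrite decr_level_neq.
rewrite (bigD1 (Ordinal rm)) //= [X in _ < X](bigD1 (Ordinal rm)) //=.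
rewrite decrE eqxx -addSn leq_add //; first by lia.
by apply: leq_sum => k ki; rewrite decrE -[r]/(val (Ordinal rm)) (inj_eq val_inj)
  (negbTE ki) subr0.
Qed.

Lemma lower_ind j m (Pr : pattern -> Prop) :
  (forall g, is_pattern g -> lowest j m g -> Pr g) ->
  (forall g h, lower_step j m g h -> Pr h -> Pr g) ->
  forall g, is_pattern g -> Pr g.
Proof.
move=> base step g; have [k] := ubnP (mass m g); elim: k g => // k IH g gk gP.
have [[h gh]|no] := pselect (exists h, lower_step j m g h).
  apply: (step _ _ gh); apply: IH; last exact: step_pattern gh.
  by have := step_mass gh; lia.
by apply: base => // h gh; apply: no; exists h.
Qed.

Lemma linked_lowest j m g : is_pattern g ->
  exists l, [/\ is_pattern l, lowest j m l & linked j m g l].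
Proof.
move: g; apply: (@lower_ind j m) => [g gP gl|g h gh [l [lP ll hl]]].
  by exists g; split=> //; exact: rst_refl.
by exists l; split=> //; apply: rst_trans hl; exact: rst_step.
Qed.

Lemma linked_level m g h l : linked 1 m g h -> m < l -> g l = h l.
Proof.
move=> + ml; elim=> {g h} [g h [_ [i im [r _ ->]]]|//|g h _ -> //|g h k _ -> _ -> //].
by rewrite decr_level_neq //; lia.
Qed.

Lemma not_lower i g : 0 < i -> is_pattern g -> (forall h, ~ lower i g h) ->
  forall s, (level_height i g s <= level_height i g i)%R.
Proof.
move=> i0 gP no; have := first_max_ex (fun r => @height_out i g r gP i0).
case=> // -[r hr]; case: (no (decr_level i r g)); by exists r.
Qed.

(** By induction on i the letters i + 1 of each row are at least as many as the
    letters i + 2 of the next row, so heights never increase with the row.  As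
    no operator applies, they never decrease either, and the two numbers
    agree. *)
Lemma lowest_level m g i r : is_pattern g -> lowest 1 m g -> i <= m ->
  g i r = g i.+1 r.+1.
Proof.
move=> gP gl; elim: i r => [|i IH] r im.
  case: (gP) => g0 gi; have := gi 0 r; have := gi 0 r.+1; rewrite !g0; lia.
have h := @not_lower i.+1 g isT gP.
have {}h : forall s, (level_height i.+1 g s <= level_height i.+1 g i.+1)%R.
  by apply: h => h gh; apply: (gl h); split=> //; exists i.+1.
have hS s : (level_height i.+1 g s.+1 =
   level_height i.+1 g s - (g i.+1 s - g i.+2 s.+1))%R.
  by rewrite /level_height /= -/(height _ _ _ _) IH; lia.
have dS s : (0 <= g i.+1 s - g i.+2 s.+1)%R by case: gP => _ /(_ i.+1 s); lia.
(* Beyond the row r the height has dropped by the difference to be shown zero. *)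
have mono s : (level_height i.+1 g s <= 0)%R /\ 
   ((s <= r)%N || (level_height i.+1 g s <= - (g i.+1 r - g i.+2 r.+1))%R).
  elim: s => [|s [IH1 IH2]]; first by [].
  have := hS s; have := dS s; have [e|ne] := eqVneq s r; first by rewrite e in IH1 *; lia.
  by lia.
have h0 : (0 <= level_height i.+1 g i.+1)%R := h 0.
have [_] := mono (maxn r.+1 i.+1).
rewrite (@height_out i.+1 g (maxn r.+1 i.+1)) //; last by lia.
by move: h0; have := dS r; lia.
Qed.

Lemma lowest_levelE m g i r : is_pattern g -> lowest 1 m g -> i <= m.+1 ->
  g i r = g m.+1 (r + (m.+1 - i)).
Proof.
move=> gP gl im.
suff main k s : k <= m.+1 -> g (m.+1 - k) s = g m.+1 (s + k).
  by rewrite -{1}(subKn im) main //; lia.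
elim: k s => [|k IH] s km; first by rewrite subn0 addn0.
rewrite (@lowest_level m) //; last by lia.
have -> : (m.+1 - k.+1).+1 = m.+1 - k by lia.
by rewrite IH ?addSnnS //; lia.
Qed.

Lemma lowest_uniq m g h : is_pattern g -> is_pattern h ->
  lowest 1 m g -> lowest 1 m h -> (forall l, m < l -> g l = h l) -> g = h.
Proof.
move=> gP hP gl hl e; apply: pattern_eq => i r; have [im|im] := leqP i m.
  have im1 := leqW im.
  by rewrite (lowest_levelE r gP gl im1) (lowest_levelE r hP hl im1) (e _ (ltnSn m)).
by rewrite (e _ im).
Qed.

(** Connectedness of the crystal of a straight shape. *)
Lemma fiber_linked m g h : is_pattern g -> is_pattern h ->
  (forall l, m < l -> g l = h l) -> linked 1 m g h.
Proof.
move=> gP hP e; have [x [xP xl gx]] := linked_lowest 1 m gP.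
have [y [yP yl hy]] := linked_lowest 1 m hP.
suff xy : x = y by apply: rst_trans gx _; rewrite xy; exact: rst_sym.
apply: (lowest_uniq xP yP xl yl) => l ml.
by rewrite -(linked_level gx ml) -(linked_level hy ml) e.
Qed.

Lemma step_evac j k m g h : 0 < j -> k <= m -> lower_step j k g h ->
  lower_step (m.+1 - k) (m.+1 - j) (evc m h) (evc m g).
Proof.
move=> j0 km gh; split; first exact/evc_pattern/(step_pattern gh).
case: gh => gP [i ijk gh]; exists (m.+1 - i); first by lia.
by apply: lower_evac => //; lia.
Qed.

Lemma linked_evac j k m g h : 0 < j -> k <= m -> linked j k g h ->
  linked (m.+1 - k) (m.+1 - j) (evc m g) (evc m h).
Proof.
move=> j0 km; elim=> {g h} [g h gh|g|g h _ IH|g h x _ IH1 _ IH2].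
- by apply/rst_sym/rst_step/step_evac.
- exact: rst_refl.
- exact: rst_sym.
- exact: rst_trans IH1 IH2.
Qed.

(** [evac m] turns the indices from j to m into those from 1 to m + 1 - j, and
    highest patterns into lowest ones. *)
Lemma highest_uniq j m g h : 0 < j <= m -> is_pattern g -> is_pattern h ->
  highest j m g -> highest j m h -> linked j m g h -> g = h.
Proof.
move=> jm gP hP gh hh /(@linked_evac j m m); rewrite subSnn => /(_ _ _) gh'.
have low x : highest j m x -> lowest 1 (m.+1 - j) (evc m x).
  move=> xh y xy; apply: (xh (evc m y)).
  have dm : m.+1 - j <= m by lia.
  have := @step_evac 1 _ m _ _ isT dm xy; rewrite evcK subn1.
  by have -> : m.+1 - (m.+1 - j) = j by lia.
apply: (can_inj (evcK m)); apply: lowest_uniq (low _ gh) (low _ hh) _;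
  try exact: evc_pattern.
by move=> l; apply: linked_level; apply: gh'; lia.
Qed.

(** [evac (m.+1 - j)] leaves the levels beyond m + 1 - j alone; this is
    conjugated by [evac m]. *)
Lemma linked_evac_itv j m g : 0 < j <= m -> is_pattern g -> linked j m g (evi j m g).
Proof.
move=> jm gP; have xP := evc_pattern m gP; set d := m.+1 - j.
have : linked 1 d (evc m g) (evc d (evc m g)).
  apply: fiber_linked => //; first exact: evc_pattern.
  by move=> l dl; rewrite (evc_level (evc m g) dl).
move/(@linked_evac 1 d m); rewrite evcK subn1 /=.
have -> : m.+1 - d = j by lia.
by apply; lia.
Qed.

Lemma step_toggle i j m g h : 0 < i -> i.+1 < j -> lower_step j m g h ->
  lower_step j m (toggle i g) (toggle i h).
Proof.
move=> i0 ij [gP [k jk gh]]; split; first exact: toggle_pattern.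
by exists k => //; apply: lower_toggle_far => //; lia.
Qed.

Lemma linked_toggle i j m g h : 0 < i -> i.+1 < j -> linked j m g h ->
  linked j m (toggle i g) (toggle i h).
Proof.
move=> i0 ij; elim=> {g h} [g h gh|g|g h _ IH|g h x _ IH1 _ IH2].
- exact/rst_step/step_toggle.
- exact: rst_refl.
- exact: rst_sym.
- exact: rst_trans IH1 IH2.
Qed.

(** Locality of the partial Schutzenberger involutions: that of the letters from
    j to m + 1 ignores the smaller letters. *)
Lemma evac_itv_toggle i j m g : 0 < i -> i.+1 < j -> j <= m -> is_pattern g ->
  evi j m (toggle i g) = toggle i (evi j m g).
Proof.
move=> i0 ij jm; have j0 : 0 < j by lia. have jm' : 0 < j <= m by lia.
have eviK : involutive (evi j m).
  move=> x; have := evac_itv_sqr toggle_perm_sqr toggle_perm_comm j m.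
  by move/(congr1 (fun f : permutation pattern => f x)).
have step_evi x y : lower_step j m x y -> lower_step j m (evi j m y) (evi j m x).
  move=> xy; split; first exact/evac_itv_pattern/(step_pattern xy).
  by case: xy => xP [k jk xy]; exists (j + m - k); [lia | apply: lower_evac_itv => //; lia].
move: g; apply: (@lower_ind j m) => [g gP gl|g h gh IH].
  have high x : lowest j m x -> highest j m (evi j m x).
    by move=> xl y /step_evi; rewrite eviK; exact: xl.
  apply: (@highest_uniq j m) => //.
  - exact/evac_itv_pattern/toggle_pattern.
  - exact/toggle_pattern/evac_itv_pattern.
  - by apply: high => y /(step_toggle i0 ij); rewrite toggleK; exact: gl.
  - by move=> y /(step_toggle i0 ij); rewrite toggleK; exact: high.
  - apply: rst_trans (linked_toggle i0 ij (linked_evac_itv jm' gP)).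
    by apply/rst_sym/linked_evac_itv/toggle_pattern.
(* One and the same operator leads from evi j m (toggle i h) to both sides. *)
have [gP [k jk hk]] := gh.
have l1 := lower_evac_itv j0 jk.2 gP hk.
have l2 : lower k (toggle i g) (toggle i h) by apply: lower_toggle_far => //; lia.
have l3 := lower_evac_itv j0 jk.2 (toggle_pattern i gP) l2.
have l4 : lower (j + m - k) (toggle i (evi j m h)) (toggle i (evi j m g)).
  by apply: lower_toggle_far => //; lia.
by rewrite IH in l3; exact: lower_fun l3 l4.
Qed.

End Schutzenberger.

(** * Tableaux as patterns *)

Section TableauPattern.
Local Open Scope nat_scope.
Implicit Types (T : seq (seq nat)) (i r c : nat).

Definition row_count T i r : nat := count (leq^~ i) (nth [::] T r).

Definition tableau_pattern T : pattern := fun i r => (row_count T i r)%:Z%R.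

Lemma row_count_iota T i r : row_count T i r =
  count (fun c => entry T r c <= i) (iota 0 (size (nth [::] T r))).
Proof.
rewrite /row_count /entry; set s := nth _ _ _.
by rewrite -{1}[s](mkseq_nth 0) /mkseq count_map.
Qed.

Lemma count_ltn_iota n k : count (ltn^~ k) (iota 0 n) = minn k n.
Proof.
elim: n => [|n IH]; first by rewrite minn0.
by rewrite -addn1 iotaD count_cat IH /=; lia.
Qed.

Section Semistandard.
Variables (N : nat) (T : seq (seq nat)).
Hypothesis HT : ssyt_axioms N T.

Lemma ltn_row_count i r c : (c < row_count T i r) = cell T r c && (entry T r c <= i).
Proof.
have [h|h] := boolP (cell T r c); last first.
  apply/negbTE; rewrite -leqNgt; apply: leq_trans (count_size _ _) _.
  by rewrite /cell -leqNgt in h.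
have hs : c <= size (nth [::] T r) by exact: ltnW.
rewrite row_count_iota -(subnKC hs) iotaD count_cat add0n /=.
have [ei|ei] := leqP (entry T r c) i.
  have /eqP -> : count (fun d => entry T r d <= i) (iota 0 c) == c.
    rewrite -{2}(size_iota 0 c) -all_count; apply/allP => d.
    rewrite mem_iota add0n => /= dc; apply: leq_trans ei.
    by apply: (entry_row HT) => //; exact: ltnW.
  rewrite -[X in X < _]addn0 ltn_add2l -has_count.
  by apply/hasP; exists c => //; rewrite mem_iota leqnn /=; move: h; rewrite /cell; lia.
have -> : count (fun d => entry T r d <= i) (iota c (size (nth [::] T r) - c)) = 0.
  apply/eqP; rewrite -leqn0 leqNgt -has_count; apply/hasPn => d.
  rewrite mem_iota => /andP[cd dn]; rewrite -ltnNge; apply: leq_trans ei _.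
  by apply: (entry_row HT) => //; rewrite /cell; lia.
apply/negbTE; rewrite -leqNgt addn0; apply: leq_trans (count_size _ _) _.
by rewrite size_iota.
Qed.

Lemma row_count_interlace i r :
  row_count T i.+1 r.+1 <= row_count T i r <= row_count T i.+1 r.
Proof.
apply/andP; split; last by apply: sub_count => x /=; lia.
rewrite leqNgt; apply/negP; rewrite ltn_row_count => /andP[h e].
have := entry_col HT (ltnSn r) h; have := cell_le HT (leqnSn r) (leqnn _) h.
move: (ltnn (row_count T i r)); rewrite ltn_row_count => + h'; rewrite h' /=; lia.
Qed.

Lemma tableau_pattern_valid : is_pattern (tableau_pattern T).
Proof.
split=> [r|i r]; last by have := row_count_interlace i r; rewrite /tableau_pattern; lia.
rewrite /tableau_pattern; congr Posz; apply/eqP; rewrite -leqn0 leqNgt ltn_row_count.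
by apply/negP => /andP[h]; case: HT => _ /(_ _ _ h) + _ _; lia.
Qed.

Lemma size_row_count r : row_count T N r = size (nth [::] T r).
Proof.
apply/eqP; rewrite eqn_leq count_size /= leqNgt; apply/negP => lt.
have h : cell T r (row_count T N r) by [].
have := ltnn (row_count T N r); rewrite ltn_row_count h.
by case: HT => _ /(_ _ _ h) /andP[_ ->].
Qed.

Variable i : nat.
Hypotheses (i_gt0 : 0 < i) (i_ltN : i < N).

Local Notation cnt := (row_count T).

(** The entries i of the row r that stay in place are those above an entry i + 1,
    and they form the leftmost ones. *)
Lemma fixed_columns r c : cell T r c ->
  (entry T r c < i) || (entry T r c == i) && ~~ is_free i T r c =
  (c < maxn (cnt i.+1 r.+1) (cnt i.-1 r)).
Proof.
move=> h; rewrite leq_max !ltn_row_count h /=.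
have [lt|ge] /= := ltnP (entry T r c) i; first by apply/esym/orP; right; lia.
have -> : entry T r c <= i.-1 = false by lia.
rewrite orbF; have [e|ne] /= := eqVneq (entry T r c) i; last first.
  apply/esym/negP => /andP[h' e']; have := entry_col HT (ltnSn r) h'; lia.
rewrite /is_free e eqxx /= negbK.
have -> : i \in column T c by apply/(columnP _ _ i_gt0); exists r.
apply/(columnP _ _ (ltn0Sn i))/andP => [[s hs es]|[h' e']]; last first.
  by exists r.+1 => //; have := entry_col HT (ltnSn r) h'; lia.
have rs : r < s.
  rewrite ltnNge; apply/negP; rewrite leq_eqVlt => /predU1P[e1|lt].
    by rewrite e1 e in es; lia.
  by have := entry_col HT lt h; lia.
have h' : cell T r.+1 c by apply: (cell_le HT rs) hs.
split=> //; rewrite -es.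
by move: rs; rewrite leq_eqVlt => /predU1P[->//|lt]; apply/ltnW/(entry_col HT).
Qed.

(** An entry i + 1 of the row r is free unless it lies under an entry i, and the
    free ones form the leftmost ones. *)
Lemma free_columns r c : cell T r c ->
  (entry T r c <= i) || is_free i T r c && (entry T r c == i.+1) =
  (c < if r is s.+1 then minn (cnt i.+1 r) (cnt i.-1 s) else cnt i.+1 r).
Proof.
move=> h.
have -> : (c < if r is s.+1 then minn (cnt i.+1 r) (cnt i.-1 s) else cnt i.+1 r) =
  (entry T r c <= i.+1) && (if r is s.+1 then entry T s c <= i.-1 else true).
  case: r h => [|r] h; first by rewrite ltn_row_count h andbT.
  by rewrite leq_min !ltn_row_count h (cell_le HT (leqnSn r) (leqnn _) h).
have [le|gt] /= := leqP (entry T r c) i.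
  rewrite leqW //=; case: r h le => // r h le.
  by have := entry_col HT (ltnSn r) h; lia.
have [e|ne] := eqVneq (entry T r c) i.+1; last by rewrite andbF; lia.
rewrite andbT e leqnn /=; rewrite /is_free e eqxx orbT /=.
have -> : i.+1 \in column T c by apply/(columnP _ _ (ltn0Sn i)); exists r.
rewrite andbT; case: r h gt e => [|r] h gt e.
  apply/negP => /(columnP _ _ i_gt0)[s hs es].
  have [lt|] := ltnP 0 s; first by have := entry_col HT lt hs; lia.
  by rewrite leqn0 => /eqP s0; rewrite s0 e in es; lia.
have lt := entry_col HT (ltnSn r) h; have h' := cell_le HT (leqnSn r) (leqnn _) h.
have [le|gt'] := leqP (entry T r c) i.-1; last first.
  by apply/negbTE; rewrite negbK; apply/(columnP _ _ i_gt0); exists r => //; lia.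
apply/negP => /(columnP _ _ i_gt0)[s hs es].
have [sr|sr|sr] := ltngtP s r; last by rewrite sr in es; lia.
  by have := entry_col HT sr h'; lia.
move: sr; rewrite leq_eqVlt => /predU1P[sr|sr]; first by rewrite -sr in es; lia.
by have := entry_col HT sr hs; lia.
Qed.

Lemma count_split (a b : pred nat) s : {in s, forall x, ~~ (a x && b x)} ->
  count (fun x => a x || b x) s = count a s + count b s.
Proof.
move=> h; rewrite -count_predUI.
have -> : count (predI a b) s = 0; last by rewrite addn0.
by apply/eqP; rewrite -leqn0 leqNgt -has_count; apply/hasPn.
Qed.

(** Rewriting k free entries i and l free entries i + 1 into l and k of them
    changes the number of entries at most i from A + k to A + l, where A counts
    the columns of [fixed_columns]; and A + k + l is the number B of those of
    [free_columns]. *)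
Lemma row_count_bk r : row_count (bk i T) i r + cnt i r =
  (if r is s.+1 then minn (cnt i.+1 r) (cnt i.-1 s) else cnt i.+1 r)
  + maxn (cnt i.+1 r.+1) (cnt i.-1 r).
Proof.
set B := (X in _ = X + _); set A := maxn _ _.
pose n := size (nth [::] T r).
have in_cell c : c \in iota 0 n -> cell T r c by rewrite mem_iota.
have cnt_le k : cnt k r <= n by exact: count_size.
have B_le : B <= n.
  by rewrite /B; case: (r) (cnt_le i.+1) => [|s]; lia.
have A_le : A <= n.
  by have := row_count_interlace i r; have := cnt_le i; have := cnt_le i.-1; lia.
pose l := count (fun d => is_free i T r d && (entry T r d == i.+1)) (iota 0 n).
have eB : cnt i r + l = B.
  rewrite -(minn_idPl B_le) -count_ltn_iota row_count_iota -count_split.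
    by apply: eq_in_count => c /in_cell h; rewrite free_columns.
  by move=> c _; apply/negP => /and3P[h _ /eqP e]; rewrite e ltnn in h.
have eA : row_count (bk i T) i r = A + l.
  rewrite row_count_iota size_bk_row -/n -(minn_idPl A_le) -count_ltn_iota.
  pose k := count (is_free i T r) (iota 0 n).
  have lk : l <= k by apply: sub_count => d /andP[].
  have <- : count (fun d => is_free i T r d &&
       (count (is_free i T r) (iota 0 d) < l)) (iota 0 n) = l.
    by rewrite count_rank; exact/ssrnat.minn_idPl.
  rewrite -count_split => [|c /in_cell h]; last first.
    rewrite /= -[c < A](fixed_columns h); apply/negP => /andP[+ /andP[f _]].
    rewrite f andbF orbF; have := free_entry f; lia.
  apply: eq_in_count => c /in_cell h.
  rewrite entry_bk //= -[c < A](fixed_columns h) /bk_entry -/n -/l.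
  have [f|f] /= := boolP (is_free i T r c); last first.
    by rewrite andbT orbF leq_eqVlt orbC.
  have /andP[h1 _] := free_entry f.
  by rewrite andbF orbF [entry T r c < i]ltnNge h1 /=; case: ifP => _; rewrite ?leqnn ?ltnn.
rewrite eA; lia.
Qed.

Lemma row_count_bk_neq l r : l != i -> row_count (bk i T) l r = cnt l r.
Proof.
move=> li; rewrite !row_count_iota size_bk_row; apply: eq_in_count => c.
rewrite mem_iota add0n => /= h; rewrite entry_bk //.
have [f|f] := boolP (is_free i T r c); last by rewrite bk_fixed_entry.
have := free_entry f; have := bk_entry_ge f; have := bk_entry_le f; lia.
Qed.

Lemma tableau_pattern_bk : tableau_pattern (bk i T) = toggle i (tableau_pattern T).
Proof.
apply: pattern_eq => l r; rewrite /toggle i_gt0 /=; case: eqP => [->|/eqP li].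
  have := row_count_bk r; rewrite /toggle_row /tableau_pattern.
  by case: r => [|r]; lia.
by rewrite /tableau_pattern row_count_bk_neq.
Qed.

End Semistandard.

Lemma row_gt0 N T r : ssyt_axioms N T -> (r < size T) = (0 < size (nth [::] T r)).
Proof.
case=> /andP[_ no0] _ _ _; apply/idP/idP => [rT|]; last exact: cell_row.
rewrite lt0n; apply: contra no0 => /eqP e; apply/(nthP 0); exists r.
  by rewrite size_map.
by rewrite (nth_map [::]).
Qed.

(** The entry in column c is the least i such that more than c entries of its row
    are at most i. *)
Lemma tableau_pattern_inj N T T' : ssyt_axioms N T -> ssyt_axioms N T' ->
  tableau_pattern T = tableau_pattern T' -> T = T'.
Proof.
move=> HT HT' e.
have er i r : row_count T i r = row_count T' i r.
  by have := congr1 (fun g : pattern => g i r) e; rewrite /tableau_pattern; lia.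
have es r : size (nth [::] T r) = size (nth [::] T' r).
  by rewrite -(size_row_count HT) -(size_row_count HT').
have eT r : (r < size T) = (r < size T').
  by rewrite (row_gt0 r HT) (row_gt0 r HT') es.
have {}eT : size T = size T'.
  by have := eT (size T); have := eT (size T'); lia.
apply: (@eq_from_nth _ [::]) => // r _; apply: (@eq_from_nth _ 0) => // c h.
have h' : cell T' r c by rewrite /cell -es.
change (entry T r c = entry T' r c); apply/eqP; rewrite eqn_leq; apply/andP; split.
  by have := ltn_row_count HT (entry T' r c) r c; rewrite er (ltn_row_count HT') h' leqnn /cell h.
by have := ltn_row_count HT' (entry T r c) r c; rewrite -er (ltn_row_count HT) h' leqnn /cell h.
Qed.

End TableauPattern.

(** * Cactus relations in the Berenstein-Kirillov group *)

Section BKRelations.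
Local Open Scope group_scope.
Variable n : nat.
Implicit Types (x y : BK n) (f : permutation pattern).

(** Relations are proved for permutations of all patterns, of which those of
    tableaux are only a part, and transported along this relation. *)
Definition acts_as x f : Prop := forall T : ssyt n.*2,
  tableau_pattern (gval x T) = f (tableau_pattern T).

Lemma acts_asM x y f g : acts_as x f -> acts_as y g -> acts_as (x * y) (f * g).
Proof. by move=> xf yg T; rewrite [gval _]valM /= -yg -xf. Qed.

Lemma acts_as1 : acts_as 1 1.
Proof. by move=> T; rewrite [gval _]val1. Qed.

Lemma acts_as_inj x y f g : acts_as x f -> acts_as y g ->
  (forall h, is_pattern h -> f h = g h) -> x = y.
Proof.
move=> xf yg fg; apply/val_inj/permutation_eq => T; apply/val_inj.
have ssytT (U : ssyt n.*2) : ssyt_axioms n.*2 U by exact/ssytP/(valP U).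
apply: (tableau_pattern_inj (ssytT _) (ssytT _)).
have := fg _ (tableau_pattern_valid (ssytT T)); rewrite -xf -yg; apply.
Qed.

Lemma bk_t_acts i : (0 < i < n.*2)%N -> acts_as (bk_t n i) (toggle_perm i).
Proof.
move=> hi T; rewrite /= hi; case/andP: hi => i0 iN.
by apply: (@tableau_pattern_bk n.*2) => //; exact/ssytP/(valP T).
Qed.

Lemma promotion_acts m : (m < n.*2)%N ->
  acts_as (promotion (bk_t n) m) (promotion toggle_perm m).
Proof.
elim: m => [|m IH] hm; first by rewrite !promotion0; exact: acts_as1.
by rewrite !promotionS; apply: acts_asM; [exact: bk_t_acts | apply: IH; lia].
Qed.

Lemma evac_acts m : (m < n.*2)%N -> acts_as (evac (bk_t n) m) (evac toggle_perm m).
Proof.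
elim: m => [|m IH] hm; first by rewrite !evac0; exact: acts_as1.
by rewrite !evacS; apply: acts_asM; [apply: IH; lia | exact: promotion_acts].
Qed.

Lemma evac_itv_acts j m : (0 < j)%N -> (m < n.*2)%N ->
  acts_as (evac_itv (bk_t n) j m) (evac_itv toggle_perm j m).
Proof. by move=> j0 hm; do 2?[apply: acts_asM]; apply: evac_acts; lia. Qed.

Lemma bk_t_sqr i : bk_t n i * bk_t n i = 1.
Proof.
by apply/val_inj/permutation_eq => T; rewrite valM; exact: bk_moveK.
Qed.

Lemma bk_t_id i : ~~ (0 < i < n.*2)%N -> bk_t n i = 1.
Proof.
by move=> hi; apply/val_inj/permutation_eq => T; apply/val_inj; rewrite /= (negbTE hi).
Qed.

Lemma bk_t_comm i j : (i.+1 < j)%N -> commute (bk_t n i) (bk_t n j).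
Proof.
move=> ij; have [hi|/bk_t_id ->] := boolP (0 < i < n.*2)%N; last first.
  exact/commute_sym/commute1.
have [hj|/bk_t_id ->] := boolP (0 < j < n.*2)%N; last exact: commute1.
apply: acts_as_inj (acts_asM (bk_t_acts hi) (bk_t_acts hj))
  (acts_asM (bk_t_acts hj) (bk_t_acts hi)) _ => h _.
exact: toggle_comm.
Qed.

Lemma bk_t_evac_itv i j m : (0 < i)%N -> (i.+1 < j)%N -> (j <= m)%N -> (m < n.*2)%N ->
  commute (bk_t n i) (evac_itv (bk_t n) j m).
Proof.
move=> i0 ij jm hm; have hi : (0 < i < n.*2)%N by lia.
have hq := evac_itv_acts (ltn_trans (ltn0Sn _) ij) hm.
apply: acts_as_inj (acts_asM (bk_t_acts hi) hq) (acts_asM hq (bk_t_acts hi)) _ => h hP.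
by apply/esym; exact: evac_itv_toggle.
Qed.

Lemma bk_q_sqr p q : bk_q n p q * bk_q n p q = 1.
Proof. exact: (evac_itv_sqr bk_t_sqr bk_t_comm). Qed.

Lemma bk_q_commute p q k l : (0 < p <= q)%N -> (q.+1 < k)%N -> (k <= l < n.*2)%N ->
  commute (bk_q n p q) (bk_q n k l).
Proof.
exact: (evac_itv_commute bk_t_sqr bk_t_comm bk_t_evac_itv).
Qed.

Lemma bk_q_conj p q k l : (0 < p <= k)%N -> (k <= l <= q)%N ->
  bk_q n k l ^ bk_q n p q = bk_q n (p + q - l) (p + q - k).
Proof. exact: (evac_itv_conj bk_t_sqr bk_t_comm). Qed.

Lemma bk_q1E q : bk_q n 1 q = bk_q1 n q.
Proof. by apply: evac_itv1; exact: (evac_evac bk_t_sqr bk_t_comm). Qed.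

End BKRelations.

(** * Symplectic families *)

Section Families.
Local Open Scope group_scope.
Variable n : nat.

(** The common relations of the two cactus groups, on elements indexed by the
    intervals [p,q] of [1,n]. *)
Record symplectic_family (G : groupType) (c : nat -> nat -> G) : Prop := {
  family_sqr : forall p q, (0 < p <= q)%N -> (q <= n)%N -> c p q * c p q = 1;
  family_disconnected : forall p q k l, (0 < p <= q)%N -> (q.+1 < k)%N ->
    (k <= l <= n)%N -> commute (c p q) (c k l);
  family_commute : forall p k l, (0 < p <= k)%N -> (k <= l <= n)%N ->
    commute (c p n) (c k l);
  family_reverse : forall p q k l, (0 < p <= k)%N -> (k <= l <= q)%N -> (q < n)%N ->
    c p q * c k l = c (p + q - l)%N (p + q - k)%N * c p q }.

Definition folded_q p q : BK n :=
  if q == n then bk_q n p (n.*2 - p) else bk_q n p q * bk_q n (n.*2 - q) (n.*2 - p).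

Lemma conjg_swap (G : groupType) (x y z : G) : y ^ x = z -> x * x = 1 -> x * y = z * x.
Proof.
by move=> <- xx; rewrite /conjg (mulg1_eq xx) -!mulgA xx mulg1.
Qed.

Lemma mulg_eq (G : groupType) (x x' y y' : G) : x = x' -> y = y' -> x * y = x' * y'.
Proof. by move=> -> ->. Qed.

Lemma bk_q_eq p p' q q' : p = p' -> q = q' -> bk_q n p q = bk_q n p' q'.
Proof. by move=> -> ->. Qed.

(** q_[p,2n-p] exchanges the two halves of a folded interval that [p,2n-p]
    contains, and these commute. *)
Lemma folded_conj p k l : (0 < p <= k)%N -> (k <= l <= n)%N ->
  folded_q k l ^ bk_q n p (n.*2 - p) = folded_q k l.
Proof.
move=> pk kln; rewrite /folded_q; case: eqP => [e|/eqP ln].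
  rewrite bk_q_conj; try lia.
  by apply: bk_q_eq; lia.
rewrite conjMg !bk_q_conj; try lia.
rewrite [RHS]bk_q_commute; try lia.
by apply: mulg_eq; apply: bk_q_eq; lia.
Qed.

Lemma folded_sqr p q : (0 < p <= q)%N -> (q <= n)%N ->
  folded_q p q * folded_q p q = 1.
Proof.
move=> pq qn; rewrite /folded_q; case: eqP => [_|ne]; first exact: bk_q_sqr.
have h : commute (bk_q n p q) (bk_q n (n.*2 - q) (n.*2 - p)).
  by apply: bk_q_commute; lia.
by rewrite {2}h -mulgA (mulgA (bk_q n (n.*2 - q) _)) bk_q_sqr mul1g bk_q_sqr.
Qed.

Lemma folded_family : symplectic_family folded_q.
Proof.
split.
- exact: folded_sqr.
- move=> p q k l pq qk kln; rewrite /folded_q [q == n]negbTE; last by lia.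
  apply/commute_sym; case: eqP => [e|/eqP ln].
    by apply: commuteM; [apply/commute_sym|]; apply: bk_q_commute; lia.
  apply: commuteM; apply/commute_sym; apply: commuteM.
  + by apply: bk_q_commute; lia.
  + by apply: bk_q_commute; lia.
  + by apply/commute_sym/bk_q_commute; lia.
  + by apply/commute_sym/bk_q_commute; lia.
- move=> p k l pk kln; rewrite {1}/folded_q eqxx.
  exact/commute_sym/commute_conjg/folded_conj.
move=> p q k l pk klq qn.
have e1 : (q == n) = false by lia.
have e2 : (l == n) = false by lia.
have e3 : (p + q - k == n)%N = false by lia.
apply: conjg_swap; last by apply: folded_sqr; lia.
rewrite /folded_q e1 e2 e3.
(* q_[p,q] reverses [k,l] inside [p,q] and commutes with the mirror image of
   [k,l]; likewise with both mirror images exchanged. *)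
rewrite conjMg !(conjgM _ (bk_q n p q)) bk_q_conj; try lia.
rewrite [bk_q n (p + q - l) _ ^ _]conjg_commute; last by apply: bk_q_commute; lia.
rewrite [bk_q n (n.*2 - l) _ ^ _]conjg_commute; last first.
  by apply/commute_sym/bk_q_commute; lia.
rewrite bk_q_conj; try lia.
by apply: mulg_eq; apply: bk_q_eq; lia.
Qed.

End Families.

Section FamilyLemmas.
Local Open Scope group_scope.
Variable n : nat.

Lemma family_map (G H : groupType) (f : {multiplicative G -> H}) c :
  symplectic_family n c -> symplectic_family n (fun p q => f (c p q)).
Proof.
case=> c1 c2 c3 c4; split=> [p q pq qn|p q k l pq qk kl|p k l pk kl|p q k l pk kl qn].
- by rewrite -gmulfM c1 // hom1.
- by rewrite /commute -!gmulfM c2.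
- by rewrite /commute -!gmulfM c3.
- by rewrite -!gmulfM c4.
Qed.

Lemma family_conj (G : groupType) (c : nat -> nat -> G) p q :
  symplectic_family n c -> (0 < p <= q)%N -> (q < n)%N ->
  c p q = c 1%N q * c 1%N (q.+1 - p)%N * (c 1%N q)^-1.
Proof.
move=> cF pq qn.
have := family_reverse cF (isT : (0 < 1 <= 1)%N) (_ : 1 <= q.+1 - p <= q)%N qn.
move=> -> //; try lia.
by rewrite mulgK; congr c; lia.
Qed.

Lemma family_uniq (G : groupType) (c c' : nat -> nat -> G) :
  symplectic_family n c -> symplectic_family n c' ->
  (forall j, (1 <= j < n)%N -> c 1%N j = c' 1%N j) ->
  (forall j, (1 <= j <= n)%N -> c j n = c' j n) ->
  forall p q, (0 < p <= q)%N -> (q <= n)%N -> c p q = c' p q.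
Proof.
move=> cF c'F e1 en p q pq qn.
have [e|ne] := eqVneq q n; first by rewrite e; apply: en; lia.
have qn' : (q < n)%N by lia.
by rewrite (family_conj cF pq qn') (family_conj c'F pq qn') !e1 //; lia.
Qed.

End FamilyLemmas.

(** * The two cactus groups as universal symplectic families *)

Section Folds.
Local Open Scope nat_scope.
Variables (n m : nat) (D : nat -> nat -> {set 'I_m.+1}).

(** The folded diagrams D p q are recognised by their nodes up to n, which form
    the interval [p,q].  This covers the diagrams of both presentations. *)
Definition folds : Prop := n <= m /\
  forall p q (i : 'I_m.+1), 0 < p <= q -> q <= n -> i <= n ->
    (i \in D p q) = (p <= i <= q).

Hypothesis foldsD : folds.

Lemma folds_mem p q i : 0 < p <= q -> q <= n -> i <= n ->
  (@inord m i \in D p q) = (p <= i <= q).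
Proof.
case: foldsD => nm memD pq qn ein.
have e : @inord m i = i :> nat by rewrite inordK; lia.
by rewrite memD // e.
Qed.

Lemma folds_inj p q k l : 0 < p <= q -> q <= n -> 0 < k <= l -> l <= n ->
  D p q = D k l -> p = k /\ q = l.
Proof.
move=> pq qn kl ln e.
have h i : i <= n -> (p <= i <= q) = (k <= i <= l).
  by move=> ein; rewrite -(folds_mem pq qn ein) -(folds_mem kl ln ein) e.
by have := h p; have := h q; have := h k; have := h l; lia.
Qed.

(** If neither interval ends before the other starts, with a gap, then the nodes
    tested below, one in each, are equal or adjacent. *)
Lemma folds_gap p q k l : 0 < p <= q -> q <= n -> 0 < k <= l -> l <= n ->
  disconnected (D p q) (D k l) -> (q.+1 < k) || (l.+1 < p).
Proof.
move=> pq qn kl ln /forall_inP dis.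
have h i j : p <= i <= q -> k <= j <= l -> (i.+1 < j) || (j.+1 < i).
  move=> pi kj; have ein : i <= n by lia. have jn : j <= n by lia.
  have /forall_inP := dis (inord i) (etrans (folds_mem pq qn ein) pi).
  move/(_ (inord j) (etrans (folds_mem kl ln jn) kj)).
  by case: foldsD => nm _; rewrite !inordK; lia.
(* For k <= p the nodes p and min p l do it, for p < k the nodes min k q and k. *)
have := h p (minn p l); have := h (minn k q) k; lia.
Qed.

Variables (X : Type) (nodes : X -> {set 'I_m.+1}).
Variables (G : groupType) (c : nat -> nat -> G).

(** The value of a family on a diagram; the default 1 is never reached. *)
Definition read_family (J : X) : G :=
  if [pick pq : 'I_n.+1 * 'I_n.+1 | (0 < pq.1 <= pq.2) && (nodes J == D pq.1 pq.2)]
  is Some pq then c pq.1 pq.2 else 1%g.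

Lemma read_familyE J p q : 0 < p <= q -> q <= n -> nodes J = D p q ->
  read_family J = c p q.
Proof.
move=> pq qn e; rewrite /read_family; case: pickP => [[k l] /= /andP[kl /eqP e']|].
  have ln : l <= n by rewrite -ltnS.
  by have [-> ->] := folds_inj pq qn kl ln (etrans (esym e) e').
have pn : p < n.+1 by lia.
move/(_ (Ordinal pn, Ordinal (qn : q < n.+1))); rewrite /= pq e eqxx //.
Qed.

End Folds.

Lemma itv_folds n : folds n (itv n).
Proof. by split=> // p q i _ _ _; rewrite inE. Qed.

Lemma mem_vpair n p q i : (i \in vpair n p q) =
  (p <= i <= q)%N || (n.*2 - q <= i <= n.*2 - p)%N.
Proof. by rewrite !inE. Qed.

Lemma vpair_folds n : (0 < n)%N -> folds n (vpair n).
Proof. by move=> n0; split=> [|p q i pq qn ein]; [|rewrite mem_vpair]; lia. Qed.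

Lemma vpair_mid n p : (0 < p <= n)%N -> vpair n p n = vmid n p.
Proof. by move=> pn; apply/setP => i; rewrite mem_vpair inE; lia. Qed.

Section SpPresentation.
Local Open Scope group_scope.
Variable n : nat.

Lemma sp_cover (J : sp_diagram n) : exists p q,
  [/\ (0 < p <= q)%N, (q <= n)%N & sp_nodes J = itv n p q].
Proof.
have /existsP[p /existsP[q /andP[pq /eqP e]]] := valP J.
by exists p, q; split=> //; rewrite -ltnS.
Qed.

(** The universal property of J_sp(2n). *)
Lemma sp_ext (G : groupType) (c : nat -> nat -> G) : symplectic_family n c ->
  exists f : {multiplicative sp_cactus n -> G}, forall p q J,
    (0 < p <= q)%N -> (q <= n)%N -> sp_nodes J = itv n p q -> f (sp_gen J) = c p q.
Proof.
case=> c1 c2 c3 c4; pose h := read_family n (itv n) (@sp_nodes n) c.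
have hE := read_familyE (itv_folds n) (nodes := @sp_nodes n) c.
have [|f fE] := @presented_ext _ _ h (@sp_relation n).
  move=> u v; case=> {u v} [J|J J' dis|p k l J J' p0 pk kl ln eJ eJ'|
    p q k l J J' J'' p0 pk kl lq qn eJ eJ' eJ'']; rewrite ?gmulfM ?hom1 !free_ext_gen.
  - have [p [q [pq qn e]]] := sp_cover J.
    by rewrite /h (hE _ _ _ pq qn e) c1.
  - have [p [q [pq qn e]]] := sp_cover J; have [k [l [kl ln e']]] := sp_cover J'.
    rewrite /h (hE _ _ _ pq qn e) (hE _ _ _ kl ln e').
    rewrite e e' in dis.
    by case/orP: (folds_gap (itv_folds n) pq qn kl ln dis) => gap; [|symmetry]; apply: c2; lia.
  - rewrite /h (hE J p n) ?(hE J' k l) //; try lia.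
    by apply: c3; lia.
  - rewrite /h (hE J p q) ?(hE J' k l) ?(hE J'' (p + q - l) (p + q - k))%N //; try lia.
    by apply: c4; lia.
by exists f => p q J pq qn e; rewrite [LHS]fE /h (hE J p q).
Qed.

Definition sp_gen_itv p q : sp_cactus n :=
  if insub (itv n p q) is Some J then sp_gen J else 1.

Lemma sp_gen_itvE J p q : sp_nodes J = itv n p q -> sp_gen_itv p q = sp_gen J.
Proof. by rewrite /sp_gen_itv => <-; rewrite valK. Qed.

Lemma sp_realize p q : (0 < p <= q)%N -> (q <= n)%N ->
  exists J : sp_diagram n, sp_nodes J = itv n p q.
Proof.
move=> pq qn; have pn : (p < n.+1)%N by lia.
suff h : is_sp_diagram (itv n p q) by exists (SpDiagram h).
by apply/existsP; exists (Ordinal pn); apply/existsP; exists (Ordinal (qn : (q < n.+1)%N));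
  rewrite /= pq eqxx.
Qed.

Lemma sp_rel_eq (J J' J'' J3 : sp_diagram n) :
  sp_relation (free_gen J * free_gen J') (free_gen J'' * free_gen J3) ->
  sp_gen J * sp_gen J' = sp_gen J'' * sp_gen J3.
Proof. by move=> r; rewrite !pgen_mulE; exact: pgen_rel. Qed.

Lemma sp_gen_family : symplectic_family n sp_gen_itv.
Proof.
split.
- move=> p q pq qn; have [J e] := sp_realize pq qn; rewrite (sp_gen_itvE e) pgen_mulE.
  exact: (pgen_rel (sp_square J)).
- move=> p q k l pq qk kln.
  have [J e] : exists J : sp_diagram n, sp_nodes J = itv n p q by apply: sp_realize; lia.
  have [J' e'] : exists J : sp_diagram n, sp_nodes J = itv n k l by apply: sp_realize; lia.
  rewrite /commute (sp_gen_itvE e) (sp_gen_itvE e').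
  apply/sp_rel_eq/sp_disconnected; rewrite e e'.
  by apply/forall_inP => i; rewrite inE => hi; apply/forall_inP => j; rewrite inE; lia.
- move=> p k l pk kln.
  have [J e] : exists J : sp_diagram n, sp_nodes J = itv n p n by apply: sp_realize; lia.
  have [J' e'] : exists J : sp_diagram n, sp_nodes J = itv n k l by apply: sp_realize; lia.
  rewrite /commute (sp_gen_itvE e) (sp_gen_itvE e').
  by apply/sp_rel_eq/(@sp_commute _ p k l) => //; lia.
- move=> p q k l pk klq qn.
  have [J e] : exists J : sp_diagram n, sp_nodes J = itv n p q by apply: sp_realize; lia.
  have [J' e'] : exists J : sp_diagram n, sp_nodes J = itv n k l by apply: sp_realize; lia.
  have [J'' e''] : exists J : sp_diagram n, sp_nodes J = itv n (p + q - l) (p + q - k).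
    by apply: sp_realize; lia.
  rewrite (sp_gen_itvE e) (sp_gen_itvE e') (sp_gen_itvE e'').
  by apply/sp_rel_eq/(@sp_reverse _ p q k l) => //; lia.
Qed.

Lemma sp_hom_uniq (G : groupType) (f f' : {multiplicative sp_cactus n -> G}) :
  (forall p q, (0 < p <= q)%N -> (q <= n)%N -> f (sp_gen_itv p q) = f' (sp_gen_itv p q)) ->
  f =1 f'.
Proof.
move=> e; apply: presented_uniq => J; have [p [q [pq qn eJ]]] := sp_cover J.
by have := e _ _ pq qn; rewrite (sp_gen_itvE eJ).
Qed.

End SpPresentation.

Section VPresentation.
Local Open Scope group_scope.
Variable n : nat.
Hypothesis n_gt0 : (0 < n)%N.

Lemma v_cover (J : v_diagram n) : exists p q,
  [/\ (0 < p <= q)%N, (q <= n)%N & v_nodes J = vpair n p q].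
Proof.
case/orP: (valP J) => [/existsP[p /andP[p0 /eqP e]]|].
  have pn : (p <= n)%N by rewrite -ltnS.
  exists p, n; split; [by lia | by lia |].
  by rewrite vpair_mid //; lia.
move=> /existsP[p /existsP[q /and4P[p0 pq qn /eqP e]]].
by exists p, q; split=> //; lia.
Qed.

Lemma v_realize p q : (0 < p <= q)%N -> (q <= n)%N ->
  exists J : v_diagram n, v_nodes J = vpair n p q.
Proof.
move=> pq qn; have pn : (p < n.+1)%N by lia.
suff h : is_v_diagram (vpair n p q) by exists (VDiagram h).
apply/orP; have [e|ne] := eqVneq q n.
  left; apply/existsP; exists (Ordinal pn); rewrite e vpair_mid /= ?eqxx; lia.
right; apply/existsP; exists (Ordinal pn); apply/existsP.
exists (Ordinal (qn : (q < n.+1)%N)); rewrite /= eqxx; lia.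
Qed.

(** The universal property of the virtual symplectic cactus group. *)
Lemma v_ext (G : groupType) (c : nat -> nat -> G) : symplectic_family n c ->
  exists f : {multiplicative v_cactus n -> G}, forall p q J,
    (0 < p <= q)%N -> (q <= n)%N -> v_nodes J = vpair n p q -> f (v_gen J) = c p q.
Proof.
have vF := vpair_folds n_gt0.
case=> c1 c2 c3 c4; pose h := read_family n (vpair n) (@v_nodes n) c.
have hE := read_familyE vF (nodes := @v_nodes n) c.
have [|f fE] := @presented_ext _ _ h (@v_relation n).
  move=> u v; case=> {u v} [J|J J' dis|p k l J J' p0 pk kl ln eJ eJ'|
    p q k l J J' J'' p0 pk kl lq qn eJ eJ' eJ'']; rewrite ?gmulfM ?hom1 !free_ext_gen.
  - have [p [q [pq qn e]]] := v_cover J.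
    by rewrite /h (hE _ _ _ pq qn e) c1.
  - have [p [q [pq qn e]]] := v_cover J; have [k [l [kl ln e']]] := v_cover J'.
    rewrite /h (hE _ _ _ pq qn e) (hE _ _ _ kl ln e').
    rewrite e e' in dis.
    by case/orP: (folds_gap vF pq qn kl ln dis) => gap; [|symmetry]; apply: c2; lia.
  - rewrite /h (hE J p n) ?(hE J' k l) // ?vpair_mid //; try lia.
    by apply: c3; lia.
  - rewrite /h (hE J p q) ?(hE J' k l) ?(hE J'' (p + q - l) (p + q - k))%N //; try lia.
    by apply: c4; lia.
by exists f => p q J pq qn e; rewrite [LHS]fE /h (hE J p q).
Qed.

Definition v_gen_pair p q : v_cactus n :=
  if insub (vpair n p q) is Some J then v_gen J else 1.

Lemma v_gen_pairE J p q : v_nodes J = vpair n p q -> v_gen_pair p q = v_gen J.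
Proof. by rewrite /v_gen_pair => <-; rewrite valK. Qed.

Lemma v_rel_eq (J J' J'' J3 : v_diagram n) :
  v_relation (free_gen J * free_gen J') (free_gen J'' * free_gen J3) ->
  v_gen J * v_gen J' = v_gen J'' * v_gen J3.
Proof. by move=> r; rewrite !pgen_mulE; exact: pgen_rel. Qed.

Lemma v_gen_family : symplectic_family n v_gen_pair.
Proof.
split.
- move=> p q pq qn; have [J e] := v_realize pq qn; rewrite (v_gen_pairE e) pgen_mulE.
  exact: (pgen_rel (v_square J)).
- move=> p q k l pq qk kln.
  have [J e] : exists J : v_diagram n, v_nodes J = vpair n p q by apply: v_realize; lia.
  have [J' e'] : exists J : v_diagram n, v_nodes J = vpair n k l by apply: v_realize; lia.
  rewrite /commute (v_gen_pairE e) (v_gen_pairE e').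
  apply/v_rel_eq/v_disconnected; rewrite e e'.
  by apply/forall_inP => i; rewrite mem_vpair => hi; apply/forall_inP => j;
    rewrite mem_vpair; lia.
- move=> p k l pk kln.
  have [J e] : exists J : v_diagram n, v_nodes J = vpair n p n by apply: v_realize; lia.
  have [J' e'] : exists J : v_diagram n, v_nodes J = vpair n k l by apply: v_realize; lia.
  rewrite /commute (v_gen_pairE e) (v_gen_pairE e').
  apply/v_rel_eq/(@v_commute _ p k l) => //; try lia.
  by rewrite e vpair_mid //; lia.
- move=> p q k l pk klq qn.
  have [J e] : exists J : v_diagram n, v_nodes J = vpair n p q by apply: v_realize; lia.
  have [J' e'] : exists J : v_diagram n, v_nodes J = vpair n k l by apply: v_realize; lia.
  have [J'' e''] : exists J : v_diagram n,
    v_nodes J = vpair n (p + q - l) (p + q - k) by apply: v_realize; lia.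
  rewrite (v_gen_pairE e) (v_gen_pairE e') (v_gen_pairE e'').
  by apply/v_rel_eq/(@v_reverse _ p q k l) => //; lia.
Qed.

Lemma v_hom_uniq (G : groupType) (f f' : {multiplicative v_cactus n -> G}) :
  (forall p q, (0 < p <= q)%N -> (q <= n)%N -> f (v_gen_pair p q) = f' (v_gen_pair p q)) ->
  f =1 f'.
Proof.
move=> e; apply: presented_uniq => J; have [p [q [pq qn eJ]]] := v_cover J.
by have := e _ _ pq qn; rewrite (v_gen_pairE eJ).
Qed.

End VPresentation.

(** * The family in the virtual symplectic Berenstein-Kirillov group *)

Section VBKFamily.
Local Open Scope group_scope.
Variable n : nat.

Lemma folded_pair j : (1 <= j < n)%N -> folded_q n 1 j = bk_q_pair n j.
Proof.
move=> jn; rewrite /folded_q [j == n]negbTE; last by lia.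
by rewrite bk_q1E /bk_q_pair.
Qed.

Lemma folded_mid j : folded_q n j n = bk_q n j (n.*2 - j).
Proof. by rewrite /folded_q eqxx. Qed.

(** The defining generators only involve intervals that start at 1 or end at n;
    the others are conjugates of these by [family_conj]. *)
Lemma folded_generated p q : (0 < p <= q)%N -> (q <= n)%N ->
  generated (@is_vbk_generator n) (folded_q n p q).
Proof.
move=> pq qn; have [gen1 genF] := generated_closed (@is_vbk_generator n).
have gen_pair j : (1 <= j < n)%N -> generated (@is_vbk_generator n) (folded_q n 1 j).
  by move=> jn; apply: generated_sub; left; exists j => //; exact: folded_pair.
have [e|ne] := eqVneq q n.
  by apply: generated_sub; right; exists p; rewrite ?e ?folded_mid //; lia.
rewrite (family_conj (folded_family n) pq); last by lia.
apply: genF; last by apply: gen_pair; lia.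
by apply: (group_closedM (generated_closed _)); apply: gen_pair; lia.
Qed.

Definition vbk_q p q : VBK n := insubd 1 (folded_q n p q).

Lemma gval_vbk p q : (0 < p <= q)%N -> (q <= n)%N -> gval (vbk_q p q) = folded_q n p q.
Proof. by move=> pq qn; apply: insubdK; exact: folded_generated. Qed.

Lemma vbk_family : symplectic_family n vbk_q.
Proof.
have [f1 f2 f3 f4] := folded_family n.
split=> [p q pq qn|p q k l pq qk kl|p k l pk kl|p q k l pk kl qn];
  apply: val_inj; rewrite !valM /=.
- by rewrite gval_vbk // f1.
- by rewrite !gval_vbk; try lia; apply: f2; lia.
- by rewrite !gval_vbk; try lia; apply: f3; lia.
- by rewrite !gval_vbk; try lia; apply: f4; lia.
Qed.

End VBKFamily.

(** * The epimorphism and the isomorphism *)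

Theorem theorem9 (n : nat) (hn : 0 < n) :
  exists psi : {multiplicative v_cactus n -> VBK n},
    [/\ v_to_bk_assignment psi,
        forall psi' : {multiplicative v_cactus n -> VBK n},
          v_to_bk_assignment psi' -> psi' =1 psi,
        forall y : VBK n, exists x : v_cactus n, psi x = y,
        exists N : normal_subgroup (v_cactus n),
          isomorphic (quotient_group N) (VBK n)
      & exists phi : {multiplicative sp_cactus n -> v_cactus n},
          [/\ sp_to_v_assignment phi,
              forall phi' : {multiplicative sp_cactus n -> v_cactus n},
                sp_to_v_assignment phi' -> phi' =1 phi,
              bijective phi
            & exists (N : normal_subgroup (sp_cactus n))
                     (f : {multiplicative quotient_group N -> VBK n}),
                bijective f /\
                forall x : sp_cactus n, f (coset N x) = psi (phi x)]].
Proof.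
have [psi psiE] := v_ext hn (vbk_family n).
have [phi phiE] := sp_ext (v_gen_family hn).
have [phiV phiVE] := v_ext hn (sp_gen_family n).
have psi_ok : v_to_bk_assignment psi.
  split=> j J jn e.
    by rewrite (psiE 1 j) ?gval_vbk ?folded_pair //; lia.
  by rewrite (psiE j n) ?gval_vbk ?folded_mid ?e ?vpair_mid //; lia.
(* The image of psi is a subgroup that contains the generators. *)
have psi_onto : forall y, exists x, psi x = y.
  case=> y yP; suff [x e] : exists x, gval (psi x) = y.
    by exists x; apply: val_inj.
  apply/asboolP.
  have /asboolP := yP => /(_ (fun z => `[< exists x, gval (psi x) = z >])); apply.
    split=> [|x z /asboolP[a <-] /asboolP[b <-]]; apply/asboolP.
      by exists 1%g; rewrite hom1 [gval _]val1.
    by exists (a * b^-1)%g; rewrite gmulfM homV -gvalV; exact: valM.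
  move=> z [] [j jn ->]; apply/asboolP.
    have [J e] : exists J : v_diagram n, v_nodes J = vpair n 1 j.
      by apply: v_realize; lia.
    by exists (v_gen J); apply: psi_ok.1.
  have [J e] : exists J : v_diagram n, v_nodes J = vpair n j n.
    by apply: v_realize; lia.
  by exists (v_gen J); apply: psi_ok.2 => //; rewrite e vpair_mid.
have phiK : cancel phi phiV.
  apply: (@sp_hom_uniq n _ (phiV \o phi) idfun) => p q pq qn /=.
  have [J e] := sp_realize pq qn; have [J' e'] := v_realize hn pq qn.
  rewrite (sp_gen_itvE e) (phiE p q) // (v_gen_pairE e') (phiVE p q) //.
  exact: sp_gen_itvE.
have phiVK : cancel phiV phi.
  apply: (@v_hom_uniq n hn _ (phi \o phiV) idfun) => p q pq qn /=.
  have [J e] := sp_realize pq qn; have [J' e'] := v_realize hn pq qn.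
  rewrite (v_gen_pairE e') (phiVE p q) // (sp_gen_itvE e) (phiE p q) //.
  exact: v_gen_pairE.
exists psi; split=> //.
- move=> psi' psi'_ok; apply: (v_hom_uniq hn).
  apply: (family_uniq (family_map psi' (v_gen_family hn))
                      (family_map psi (v_gen_family hn))) => j jn.
    have [J e] : exists J : v_diagram n, v_nodes J = vpair n 1 j.
      by apply: v_realize; lia.
    by apply: val_inj; rewrite /= (v_gen_pairE e) (psi'_ok.1 j) // (psi_ok.1 j).
  have [J e] : exists J : v_diagram n, v_nodes J = vpair n j n.
    by apply: v_realize; lia.
  by apply: val_inj; rewrite /= (v_gen_pairE e) (psi'_ok.2 j) ?(psi_ok.2 j) // e vpair_mid.
- have [f [f_bij _]] := first_isomorphism psi_onto.
  by exists (ker psi), f.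
exists phi; split.
- split=> j I J jn eI eJ.
    by rewrite (phiE 1%N j) ?(v_gen_pairE eJ) //; lia.
  by rewrite (phiE j n) ?(@v_gen_pairE _ J) ?vpair_mid //; lia.
- move=> phi' phi'_ok; apply: sp_hom_uniq.
  apply: (family_uniq (family_map phi' (sp_gen_family n))
                      (family_map phi (sp_gen_family n))) => j jn.
    have [I e] : exists J : sp_diagram n, sp_nodes J = itv n 1 j.
      by apply: sp_realize; lia.
    have [J e'] : exists J : v_diagram n, v_nodes J = vpair n 1 j.
      by apply: v_realize; lia.
    rewrite (sp_gen_itvE e) (phi'_ok.1 j I J) // (phiE 1%N j) ?(v_gen_pairE e') //; lia.
  have [I e] : exists J : sp_diagram n, sp_nodes J = itv n j n.
    by apply: sp_realize; lia.
  have [J e'] : exists J : v_diagram n, v_nodes J = vpair n j n.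
    by apply: v_realize; lia.
  rewrite (sp_gen_itvE e) (phi'_ok.2 j I J) // ?(phiE j n) ?(v_gen_pairE e') //; try lia.
  by rewrite e' vpair_mid.
- by exists phiV.
have [y|f [f_bij fE]] := @first_isomorphism _ _ (psi \o phi).
  by have [x e] := psi_onto y; exists (phiV x); rewrite /= phiVK.
by exists (ker (psi \o phi)), f.
Qed.
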